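(* There exists a universal constant $C\in(0,\infty)$ such that for every $\varepsilon\in(0,1/2]$ and $p\in[2,\infty)$ there exists a mapping $F_{\varepsilon,p}:\mathbb{H}\to L_p$ such that $F_{\varepsilon,p}(\mathbb{H})\subseteq L_p$ (with the metric induced by $\|\cdot\|_p$) is $2^{16}$-doubling and $$\forall\,x,y\in\mathbb{H},\qquad d_W(x,y)^{1-\varepsilon}\le\|F_{\varepsilon,p}(x)-F_{\varepsilon,p}(y)\|_p\le C\,\frac{d_W(x,y)^{1-\varepsilon}}{\varepsilon^{1/p}}.$$
   Context: $\mathbb{H}$ denotes the discrete Heisenberg group: the group generated by two elements $a,b$ with the relations asserting that the commutator $[a,b]=aba^{-1}b^{-1}$ lies in the center. $d_W$ is the left-invariant word metric on $\mathbb{H}$ induced by the symmetric generating set $\{a,b,a^{-1},b^{-1}\}$. $L_p$ denotes, as usual, the Banach space $L_p([0,1])$ (Lebesgue measure, real-valued functions) with norm $\|\cdot\|_p$. Given $K\in[1,\infty)$, a metric space $X$ is $K$-doubling if every ball in $X$ (centre in $X$) can be covered by at most $K$ balls in $X$ of half its radius; balls are closed. *)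

(* Defs.v *)
From HB Require Import structures.
From mathcomp Require Import all_boot all_order all_algebra.
From mathcomp Require Import generic_quotient.
From mathcomp Require Import all_classical all_reals all_analysis.
Set Implicit Arguments.
Unset Strict Implicit.
Unset Printing Implicit Defensive.
Import Order.TTheory GRing.Theory Num.Theory.

Local Open Scope classical_set_scope.

(* Words in a, b, a^-1, b^-1: the first component selects the generator
   (false for a, true for b), the second one tells whether it is inverted. *)
Definition letter := (bool * bool)%type.
Definition word := seq letter.

Definition letter_inv (l : letter) : letter := (l.1, ~~ l.2).
Definition word_inv (w : word) : word := rev (map letter_inv w).

Definition word_a : word := [:: (false, false)].
Definition word_b : word := [:: (true, false)].
Definition word_comm : word :=
  word_a ++ word_b ++ word_inv word_a ++ word_inv word_b.

(* The congruence on words defining < a, b | [a, b] is central >. *)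
Inductive heis_rel : word -> word -> Prop :=
| heis_rel_refl w : heis_rel w w
| heis_rel_sym v w : heis_rel v w -> heis_rel w v
| heis_rel_trans u v w : heis_rel u v -> heis_rel v w -> heis_rel u w
| heis_rel_cat v v' w w' :
    heis_rel v v' -> heis_rel w w' -> heis_rel (v ++ w) (v' ++ w')
| heis_rel_inv l : heis_rel [:: l; letter_inv l] [::]
| heis_rel_central w : heis_rel (word_comm ++ w) (w ++ word_comm).

Definition heis_eq (v w : word) : bool := `[< heis_rel v w >].

Lemma heis_eq_refl : reflexive heis_eq.
Proof. by move=> w; apply/asboolP/heis_rel_refl. Qed.

Lemma heis_eq_sym : symmetric heis_eq.
Proof.
by move=> v w; apply/idP/idP => /asboolP h; apply/asboolP/heis_rel_sym.
Qed.

Lemma heis_eq_trans : transitive heis_eq.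
Proof.
by move=> v u w /asboolP h1 /asboolP h2; apply/asboolP/(heis_rel_trans h1 h2).
Qed.

Canonical heis_eq_equiv :=
  EquivRel heis_eq heis_eq_refl heis_eq_sym heis_eq_trans.

Local Open Scope quotient_scope.

Definition heis : Type := {eq_quot heis_eq}.
HB.instance Definition _ := Choice.on heis.
HB.instance Definition _ := EqQuotient.on heis.

Lemma heisP (v w : word) : \pi_heis v = \pi_heis w <-> heis_rel v w.
Proof. by split=> [/eqmodP/asboolP //|h]; apply/eqmodP/asboolP. Qed.

Lemma heis_rel_repr (w : word) : heis_rel (repr (\pi_heis w)) w.
Proof. by apply/heisP; rewrite reprK. Qed.

Lemma letter_invK : involutive letter_inv.
Proof. by case=> g e; rewrite /letter_inv /= negbK. Qed.

Lemma word_inv_cons l w : word_inv (l :: w) = word_inv w ++ [:: letter_inv l].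
Proof. by rewrite /word_inv /= rev_cons cats1. Qed.

Lemma word_inv_cat v w : word_inv (v ++ w) = word_inv w ++ word_inv v.
Proof. by rewrite /word_inv map_cat rev_cat. Qed.

Lemma word_invK : involutive word_inv.
Proof.
by move=> w; rewrite /word_inv map_rev revK mapK //; exact: letter_invK.
Qed.

Lemma heis_rel_mulwV w : heis_rel (w ++ word_inv w) [::].
Proof.
elim: w => [|l w IH]; first exact: heis_rel_refl.
rewrite word_inv_cons catA /=.
apply: heis_rel_trans (heis_rel_inv l).
rewrite -[l :: _]/([:: l] ++ (w ++ word_inv w) ++ [:: letter_inv l]).
rewrite -[X in heis_rel _ X]/([:: l] ++ [::] ++ [:: letter_inv l]).
by apply: heis_rel_cat (heis_rel_refl _) (heis_rel_cat IH (heis_rel_refl _)).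
Qed.

Lemma heis_rel_mulVw w : heis_rel (word_inv w ++ w) [::].
Proof. by have := heis_rel_mulwV (word_inv w); rewrite word_invK. Qed.

Lemma heis_rel_word_inv v w : heis_rel v w -> heis_rel (word_inv v) (word_inv w).
Proof.
move=> h; have r := heis_rel_refl; have s := heis_rel_sym.
apply: (@heis_rel_trans _ (word_inv v ++ (w ++ word_inv w))).
  rewrite -{1}[word_inv v]cats0.
  by apply: heis_rel_cat => //; exact/s/heis_rel_mulwV.
rewrite catA -{2}[word_inv w]cat0s; apply: heis_rel_cat => //.
apply: heis_rel_trans (heis_rel_mulVw v).
by apply: heis_rel_cat => //; exact: s.
Qed.

Definition heis_one : heis := \pi_heis [::].
Definition heis_mul (x y : heis) : heis := \pi_heis (repr x ++ repr y).
Definition heis_inv (x : heis) : heis := \pi_heis (word_inv (repr x)).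

Lemma heis_mulE v w : heis_mul (\pi_heis v) (\pi_heis w) = \pi_heis (v ++ w).
Proof. by apply/heisP/heis_rel_cat; exact: heis_rel_repr. Qed.

Lemma heis_invE w : heis_inv (\pi_heis w) = \pi_heis (word_inv w).
Proof. by apply/heisP/heis_rel_word_inv; exact: heis_rel_repr. Qed.

Lemma heis_mulA : associative heis_mul.
Proof.
move=> x y z; rewrite -[x]reprK -[y]reprK -[z]reprK.
rewrite (heis_mulE (repr y)) (heis_mulE (repr x)) (heis_mulE (repr x)).
by rewrite heis_mulE catA.
Qed.

Lemma heis_mul1 : left_id heis_one heis_mul.
Proof. by move=> x; rewrite -[x]reprK heis_mulE. Qed.

Lemma heis_mul1r : right_id heis_one heis_mul.
Proof. by move=> x; rewrite -[x]reprK heis_mulE cats0. Qed.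

Lemma heis_mulV : left_inverse heis_one heis_inv heis_mul.
Proof.
by move=> x; rewrite -[x]reprK heis_invE heis_mulE; exact/heisP/heis_rel_mulVw.
Qed.

Lemma heis_mulVr : right_inverse heis_one heis_inv heis_mul.
Proof.
by move=> x; rewrite -[x]reprK heis_invE heis_mulE; exact/heisP/heis_rel_mulwV.
Qed.

HB.instance Definition _ := isGroup.Build heis
  heis_mulA heis_mul1 heis_mul1r heis_mulV heis_mulVr.

Definition heis_a : heis := \pi_heis word_a.
Definition heis_b : heis := \pi_heis word_b.

Definition heis_gens : seq heis :=
  [:: heis_a; heis_b; heis_a^-1%g; heis_b^-1%g].

Definition heis_word_length (x : heis) (n : nat) : Prop :=
  exists s : seq heis, [/\ size s = n, all [in heis_gens] s &
                           x = (\prod_(g <- s) g)%g].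

Lemma heis_generated (x : heis) : exists n, `[< heis_word_length x n >].
Proof.
exists (size (repr x)); apply/asboolP.
exists [seq \pi_heis [:: l] | l <- repr x]; rewrite size_map; split => //.
  apply/allP => _ /mapP[[g e] _ ->]; rewrite !inE.
  have -> : heis_a^-1%g = \pi_heis (word_inv word_a) by exact: heis_invE.
  have -> : heis_b^-1%g = \pi_heis (word_inv word_b) by exact: heis_invE.
  by case: g; case: e; rewrite eqxx ?orbT.
rewrite -[LHS]reprK; elim: (repr x) => [|l w IH]; first by rewrite big_nil.
rewrite /= big_cons -IH; apply: esym; exact: heis_mulE.
Qed.

Definition heis_norm (x : heis) : nat := ex_minn (heis_generated x).

Definition dW (x y : heis) : nat := heis_norm (x^-1 * y)%g.

Local Open Scope ring_scope.

(* Not the library's closed_ball, which is the closure of an open ball. *)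
Definition cball (R : realType) (T : Type) (d : T -> T -> R) (x : T) (r : R) :
  set T := [set y | d x y <= r].

(* X is a K-doubling metric space for the restriction of the metric d. *)
Definition doubling (R : realType) (T : Type) (d : T -> T -> R) (X : set T)
    (K : R) : Prop :=
  forall (x : T) (r : R), X x -> 0 <= r ->
    exists (n : nat) (c : 'I_n -> T),
      [/\ n%:R <= K, forall i, X (c i) &
          X `&` cball d x r `<=` \bigcup_i cball d (c i) (r / 2)].

Definition leb01 (R : realType) : {measure set (measurableTypeR R) -> \bar R} :=
  mrestr lebesgue_measure (measurable_itv `[0%R, 1%R]).

(* Functions on [0, 1] are represented by functions on R up to equality almost
   everywhere for Lebesgue measure restricted to [0, 1]. *)
Definition Lp01 (R : realType) (p : R) (p1 : (1 <= p%:E)%E) : Type :=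
  LspaceType (leb01 R) p1.

Lemma le1_of_le2 (R : realType) (p : R) : 2 <= p -> (1 <= p%:E)%E.
Proof. by move=> p2; rewrite lee_fin (le_trans _ p2)// ler1n. Qed.

Definition Lp_dist (R : realType) (p : R) (p1 : (1 <= p%:E)%E)
    (f g : Lp01 p1) : R :=
  fine (Lnorm (leb01 R) p%:E (fun t => (f t - g t)%:E)).

Lemma Lp_distE (R : realType) (p : R) (p1 : (1 <= p%:E)%E) (f g : Lp01 p1) :
  (Lp_dist f g)%:E = Lnorm (leb01 R) p%:E (fun t => (f t - g t)%:E).
Proof.
have mf (h : Lp01 p1) : measurable_fun [set: R] (h : R -> R).
  exact: (measurable_funPT (repr (LebesgueSpace.sort h))).
have fin (h : Lp01 p1) : finite_norm (leb01 R) p%:E h by exact: Lebesgue_finite.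
rewrite /Lp_dist fineK// fin_numElt (lt_le_trans ltNy0) ?Lnorm_ge0//=.
have mNg : measurable_fun [set: R] (-%R \o (g : R -> R)).
  by apply: measurableT_comp => //; exact: mf.
apply: le_lt_trans (eminkowski (leb01 R) (mf f) mNg p1) _.
have -> : EFin \o (-%R \o g) = (\- (EFin \o g))%E by [].
by rewrite oppe_Lnorm lte_add_pinfty//; exact: fin.
Qed.

(* Main.v *)
(* Let phi_k(h) = max(0, 2^k - |h|) for a homogeneous gauge |.| on the discrete
   Heisenberg group. The cocycle g |-> (w_k (phi_k(g^-1 h) - phi_k(h)))_(k, h), for
   w_k = 2^(-k (e + 4/q)), takes values in l_q, and its norm N(g) is comparable to
   |g|^(1-e), with an upper constant of order e^(-1/q). It defines a left invariant
   metric for which N(delta(g)) = 2^(1-e) N(g) + O(1), where delta is the dilation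
   by 2. Restricting the cocycle to delta^n of the group and rescaling, the error
   becomes negligible, and a volume argument in a group of growth 4 bounds by
   lambda^(4/(1-e)) the number of r/2-separated points of a ball of radius r, for
   lambda slightly larger than 5. This settles eps <= 2/5, with q = p and e = eps,
   since 5 < 16^(3/5).

   For eps > 2/5 one needs a metric which is itself a snowflake. As phi_k is
   integer valued, it can be composed with an almost isometric embedding of
   (Z, |.|^(2/3)) in l_p, obtained from translates of x |-> max(0, x)^(2/3 - 1/p);
   the norm is then nearly N^(2/3) with q = 2p/3 and e = 1 - (3/2)(1 - eps), and
   there are at most 2^16 separated points since
   1 + 2 (2.2)^(3/2) < 16^(3/4). *)
From HB Require Import structures.
Require Import Defs.
From mathcomp Require Import all_boot all_order all_algebra generic_quotient.
From mathcomp Require Import all_classical all_reals all_analysis.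
From mathcomp Require Import measurable_realfun.
From mathcomp Require Import ring lra zify.
Set Implicit Arguments.
Unset Strict Implicit.
Unset Printing Implicit Defensive.
Import Order.TTheory GRing.Theory Num.Theory.
Import numFieldNormedType.Exports.
Local Open Scope classical_set_scope.
Local Open Scope ring_scope.

(** * Sequences in l_p *)

(** The obstacle is uniformity. The cocycle norm is comparable to the gauge only up to a factor of
    order e^(-1/q), so comparing volumes of balls directly would give a doubling constant depending
    on eps and p. The count therefore relies on the triangle inequality and on near homogeneity
    under dilation: m separated points yield m^i distinct products of dilates, and every comparison
    constant disappears in the i-th root, leaving the exact growth 16^4 = 2^16 of the volume over
    four dilations.

    If tau is the separation of points in a ball of radius r, the products stay distinct and
    confined when 2 r + tau < 16^(1-e) tau. For tau = r / 2 this reads 5 < 16^(1-e), which at e =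
    1/2 would be 5 < 4. Passing to a power th < 1 of the metric has two effects: the separation
    needed becomes r / 2^(1/th), which is worse, but the exponent of the underlying length rises
    from 1 - eps to (1 - eps) / th, which is better. For th = 2/3 the gain outweighs the loss, and
    the room left pays for an embedding of the integers that is only almost isometric, hence 2.2 in
    place of 2. *)

HB.lock Definition psum (R : realType) (T : choiceType) (p : R) (x : T -> R) : \bar R :=
  (\esum_(t in [set: T]) (`|x t| `^ p)%:E)%E.

(* Meaningful only for x in l_p: fine sends +oo to 0. *)
HB.lock Definition pnorm (R : realType) (T : choiceType) (p : R) (x : T -> R) : R :=
  fine (psum p x) `^ p^-1.

Arguments psum {R T} p x.
Arguments pnorm {R T} p x.

Definition lp (R : realType) (T : choiceType) (p : R) (x : T -> R) : Prop :=
  (psum p x < +oo)%E.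

(** Sequences are carried to [nat] because Minkowski's inequality is taken there, for the counting
    measure, and because the dyadic intervals of [0, 1] are numbered by [nat]. Codes that name no
    element receive 0. *)
Definition nat_lift (R : realType) (T : countType) (x : T -> R) (n : nat) : R :=
  oapp x 0 (pickle_inv n).

Section lp.
Context (R : realType).
Implicit Types (p : R).

Lemma psum_ge0 (T : choiceType) p (x : T -> R) : (0 <= psum p x)%E.
Proof. by rewrite psum.unlock; apply: esum_ge0 => t _; rewrite lee_fin powR_ge0. Qed.

Lemma psum_fine (T : choiceType) p (x : T -> R) : lp p x ->
  (fine (psum p x))%:E = psum p x.
Proof. by move=> xp; rewrite fineK// ge0_fin_numE// psum_ge0. Qed.

Lemma fine_psum_ge0 (T : choiceType) p (x : T -> R) : 0 <= fine (psum p x).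
Proof. by rewrite fine_ge0// psum_ge0. Qed.

Lemma pnorm_ge0 (T : choiceType) p (x : T -> R) : 0 <= pnorm p x.
Proof. by rewrite pnorm.unlock powR_ge0. Qed.

Lemma powR_pnorm (T : choiceType) p (x : T -> R) : p != 0 ->
  pnorm p x `^ p = fine (psum p x).
Proof. by move=> p0; rewrite pnorm.unlock -powRrM mulVf// powRr1// fine_psum_ge0. Qed.

Lemma psum_eq (T : choiceType) p (x y : T -> R) : (forall t, `|x t| = `|y t|) ->
  psum p x = psum p y.
Proof. by move=> xy; rewrite psum.unlock; apply: eq_esum => t _; rewrite xy. Qed.

Lemma pnorm_eq (T : choiceType) p (x y : T -> R) : (forall t, `|x t| = `|y t|) ->
  pnorm p x = pnorm p y.
Proof. by move=> xy; rewrite pnorm.unlock (psum_eq _ xy). Qed.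

Lemma le_psum (T : choiceType) p (x y : T -> R) : 0 <= p ->
  (forall t, `|x t| <= `|y t|) -> (psum p x <= psum p y)%E.
Proof.
by move=> p0 xy; rewrite psum.unlock; apply: le_esum => t _; rewrite lee_fin ge0_ler_powR ?nnegrE.
Qed.

Lemma le_lp (T : choiceType) p (x y : T -> R) : 0 <= p ->
  (forall t, `|x t| <= `|y t|) -> lp p y -> lp p x.
Proof. by move=> p0 xy; apply: le_lt_trans; exact: le_psum. Qed.

Lemma le_pnorm (T : choiceType) p (x y : T -> R) : 0 < p ->
  (forall t, `|x t| <= `|y t|) -> lp p y -> pnorm p x <= pnorm p y.
Proof.
move=> p0 xy yp; rewrite pnorm.unlock ge0_ler_powR ?invr_ge0 ?nnegrE ?fine_psum_ge0 ?(ltW p0)//.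
rewrite -lee_fin !psum_fine ?le_psum ?(ltW p0)//.
by apply: le_lp xy yp; exact: ltW.
Qed.

Lemma psum_reindex (T T' : choiceType) p (e : T -> T') (x : T' -> R) :
  bijective e -> psum p x = psum p (x \o e).
Proof.
rewrite -setTT_bijective => eb; rewrite psum.unlock.
exact: (reindex_esum [set: T] [set: T'] e (fun t => (`|x t| `^ p)%:E)).
Qed.

Lemma psum_pair (T T' : choiceType) p (x : T * T' -> R) :
  psum p x = (\esum_(i in [set: T]) psum p (fun j => x (i, j)))%E.
Proof.
rewrite psum.unlock (esum_esum (J := fun=> setT)); last first.
  by move=> *; rewrite lee_fin powR_ge0.
have -> : [set: T] `*`` (fun=> [set: T']) = [set: T * T'] by apply/seteqP; split.
by apply: eq_esum => -[i j].
Qed.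

(** Terms off the range of [e] vanish because 0 to the power [p] is 0; this fails at [p = 0], where
    [powR] gives 1. *)
Lemma psum_inj (T T' : choiceType) p (e : T -> T') (x : T' -> R) : p != 0 ->
  injective e -> (forall t, (~ exists s, t = e s) -> x t = 0) -> psum p x = psum p (x \o e).
Proof.
move=> p0 ei xe; rewrite psum.unlock.
transitivity (\esum_(t in e @` setT) (`|x t| `^ p)%:E)%E; last first.
  by rewrite esum_image// => s t _ _; exact: ei.
rewrite [RHS]esum_mkcond; apply: eq_esum => t _; case: ifPn => // /negP.
rewrite inE /= => te; rewrite xe ?normr0 ?powR0// => -[s tes]; apply: te.
by exists s.
Qed.

Lemma psum_nat_lift (T : countType) p (x : T -> R) : p != 0 ->
  psum p x = psum p (nat_lift x).
Proof.
move=> p0; rewrite (psum_inj p0 (pcan_inj (@pickleK T))).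
  by apply: psum_eq => t; rewrite /nat_lift /= pickleK_inv.
move=> n nT; rewrite /nat_lift; case E : (pickle_inv n) => [t|//] /=.
by case: nT; exists t; have := @pickle_invK T n; rewrite E.
Qed.

Lemma psum_series p (x : nat -> R) :
  psum p x = (\sum_(n <oo) (`|x n| `^ p)%:E)%E.
Proof. by rewrite psum.unlock nneseries_esumT// => n; rewrite lee_fin powR_ge0. Qed.

Lemma Lnorm_counting_psum p (x : nat -> R) : 0 < p ->
  Lnorm (counting : {measure set nat -> \bar R}) p%:E (EFin \o x) = (psum p x `^ p^-1)%E.
Proof.
by move=> p0; rewrite Lnorm_counting// psum_series.
Qed.

(** Kept in the extended reals so that it yields both the finiteness in [lpD] and the triangle
    inequality in [pnormD]. *)
Lemma psum_minkowski (T : countType) p (x y : T -> R) : 1 <= p ->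
  (psum p (fun t => (x t + y t)%R) `^ p^-1 <= psum p x `^ p^-1 + psum p y `^ p^-1)%E.
Proof.
move=> p1; have p0 : 0 < p by exact: lt_le_trans p1.
have pn0 : p != 0 by rewrite gt_eqF.
rewrite (psum_nat_lift x)// (psum_nat_lift y)// psum_nat_lift//.
rewrite -!Lnorm_counting_psum//.
have -> : nat_lift (fun t => x t + y t) = nat_lift x \+ nat_lift y.
  by apply/funext => n; rewrite /nat_lift /=; case: pickle_inv => //=; rewrite addr0.
by apply: minkowski_EFin.
Qed.

Lemma EFin_pnorm (T : choiceType) p (x : T -> R) : lp p x ->
  (pnorm p x)%:E = (psum p x `^ p^-1)%E.
Proof. by move=> xp; rewrite pnorm.unlock -poweR_EFin psum_fine. Qed.

Lemma lpD (T : countType) p (x y : T -> R) : 1 <= p -> lp p x -> lp p y ->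
  lp p (fun t => x t + y t).
Proof.
move=> p1 xp yp; have p0 : 0 < p by exact: lt_le_trans p1.
apply: (@lty_poweRy _ _ p^-1); first by rewrite invr_eq0 gt_eqF.
by apply: le_lt_trans (psum_minkowski x y p1) _; rewrite lte_add_pinfty// poweR_lty.
Qed.

Lemma pnormD (T : countType) p (x y : T -> R) : 1 <= p -> lp p x -> lp p y ->
  pnorm p (fun t => x t + y t) <= pnorm p x + pnorm p y.
Proof.
move=> p1 xp yp; rewrite -lee_fin EFinD !EFin_pnorm//; last exact: lpD.
exact: psum_minkowski.
Qed.

Lemma lpN (T : choiceType) p (x : T -> R) : lp p x -> lp p (fun t => - x t).
Proof. by rewrite /lp (@psum_eq _ p _ x)// => t; rewrite normrN. Qed.

Lemma lpB (T : countType) p (x y : T -> R) : 1 <= p -> lp p x -> lp p y ->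
  lp p (fun t => x t - y t).
Proof. by move=> p1 xp yp; apply: lpD => //; exact: lpN. Qed.

Lemma pnorm_dist (T : countType) p (x y : T -> R) : 1 <= p -> lp p x -> lp p y ->
  `|pnorm p x - pnorm p y| <= pnorm p (fun t => x t - y t).
Proof.
move=> p1 xp yp; have xyp := lpB p1 xp yp.
rewrite ler_norml; apply/andP; split.
  have -> : pnorm p (fun t => x t - y t) = pnorm p (fun t => y t - x t).
    by apply: pnorm_eq => t; rewrite distrC.
  rewrite lerNl opprB lerBlDr.
  have -> : pnorm p y = pnorm p (fun t => (y t - x t) + x t).
    by apply: pnorm_eq => t; rewrite subrK.
  by apply: pnormD => //; exact: lpB.
rewrite lerBlDr.
have -> : pnorm p x = pnorm p (fun t => (x t - y t) + y t).
  by apply: pnorm_eq => t; rewrite subrK.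
exact: pnormD.
Qed.

Lemma esumZ (T : choiceType) (a : T -> \bar R) (c : R) :
  0 <= c -> (forall t, 0 <= a t)%E ->
  (\esum_(t in [set: T]) (c%:E * a t) = c%:E * \esum_(t in [set: T]) a t)%E.
Proof.
have le_esumZ (b : R) (u : T -> \bar R) : 0 < b -> (forall t, 0 <= u t)%E ->
    (\esum_(t in [set: T]) (b%:E * u t) <= b%:E * \esum_(t in [set: T]) u t)%E.
  move=> b0 u0; apply: ge_ereal_sup => _ [X [finX _] <-].
  rewrite fsbig_finite//= -ge0_sume_distrr; last by move=> t _.
  apply: lee_wpmul2l; first by rewrite lee_fin ltW.
  by apply: ereal_sup_ubound; exists X => //; rewrite fsbig_finite.
rewrite le_eqVlt => /predU1P[<-|c0] a0.
  by rewrite mul0e esum1// => t _; rewrite mul0e.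
apply/eqP; rewrite eq_le le_esumZ//=.
(* The converse inequality is the one just proved, for the factor [c^-1] and the family [c * a]. *)
have ci : 0 < c^-1 by rewrite invr_gt0.
have := @le_esumZ c^-1 (fun t => c%:E * a t)%E ci.
under eq_esum do rewrite muleA -EFinM mulVf ?gt_eqF// mul1e.
move=> /(_ (fun t => mule_ge0 (ltW (_ : 0 < c%:E)%E) (a0 t))) h.
rewrite -[leRHS]mul1e -(@mulfV _ c) ?gt_eqF// EFinM -muleA.
by apply: lee_wpmul2l; [rewrite lee_fin ltW|apply: h; rewrite ?lte_fin].
Qed.

Lemma psumZ (T : choiceType) p (c : R) (x : T -> R) :
  psum p (fun t => c * x t) = ((`|c| `^ p)%:E * psum p x)%E.
Proof.
rewrite psum.unlock; have t0 (t : T) : (0 <= (`|x t| `^ p)%:E)%E.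
  by rewrite lee_fin powR_ge0.
rewrite -(esumZ (powR_ge0 _ _) t0).
by apply: eq_esum => t _; rewrite normrM powRM// EFinM.
Qed.

Lemma lpZ (T : choiceType) p (c : R) (x : T -> R) : lp p x -> lp p (fun t => c * x t).
Proof. by move=> xp; rewrite /lp psumZ -psum_fine// -EFinM ltry. Qed.

Lemma pnormZ (T : choiceType) p (c : R) (x : T -> R) : 0 < p ->
  pnorm p (fun t => c * x t) = `|c| * pnorm p x.
Proof.
move=> p0; rewrite pnorm.unlock psumZ.
have [->|c0] := eqVneq c 0.
  by rewrite normr0 powR0 ?gt_eqF// mul0e/= mul0r powR0// invr_eq0 gt_eqF.
have -> : fine ((`|c| `^ p)%:E * psum p x) = `|c| `^ p * fine (psum p x).
  (* Summability is not assumed: an infinite sum remains infinite after scaling by [c != 0], and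
     [fine] sends both to 0. *)
  have := psum_ge0 p x; case: (psum p x) => //= _.
  by rewrite gt0_muley ?lte_fin ?powR_gt0 ?normr_gt0//= mulr0.
by rewrite powRM ?powR_ge0 ?fine_psum_ge0// -powRrM mulfV ?gt_eqF// powRr1.
Qed.

Lemma pnorm_reindex (T T' : choiceType) p (e : T -> T') (x : T' -> R) :
  bijective e -> pnorm p x = pnorm p (x \o e).
Proof. by move=> eb; rewrite pnorm.unlock (psum_reindex _ _ eb). Qed.

Lemma lp_reindex (T T' : choiceType) p (e : T -> T') (x : T' -> R) :
  bijective e -> lp p x -> lp p (x \o e).
Proof. by move=> eb; rewrite /lp -psum_reindex. Qed.

End lp.

Section more_lp.
Context (R : realType).
Implicit Types (p : R).

Lemma psum_nat_le p (x : nat -> R) (B : R) :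
  (forall N, \sum_(n < N) `|x n| `^ p <= B) -> (psum p x <= B%:E)%E.
Proof.
move=> xB; rewrite psum_series; apply: lime_le.
  by apply: is_cvg_nneseries => n _ _; rewrite lee_fin powR_ge0.
by apply: nearW => N; rewrite big_mkord sumEFin lee_fin.
Qed.

Lemma psum_fst (T : choiceType) (C : finType) p (x : T -> R) : 
  psum p (fun t : T * C => x t.1) = (#|C|%:R%:E * psum p x)%E.
Proof.
have x0 t : (0 <= (`|x t| `^ p)%:E)%E by rewrite lee_fin powR_ge0.
rewrite psum_pair [in RHS]psum.unlock -(esumZ (ler0n _ _) x0).
apply: eq_esum => t _; rewrite psum.unlock (esum_fset finite_finset); last first.
  by move=> c _; rewrite lee_fin powR_ge0.
have -> : [set: C] = [set` enum C].
  by apply/seteqP; split => c //= _; rewrite mem_enum.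
rewrite -fsbig_seq ?enum_uniq//= sumEFin big_const_seq count_predT -cardE.
by rewrite iter_addr_0 -EFinM mulr_natl.
Qed.

Lemma normr_le_pnorm (T : choiceType) p (x : T -> R) t : 0 < p -> lp p x ->
  `|x t| <= pnorm p x.
Proof.
move=> p0 xp; rewrite -[leLHS]powRr1// -(@mulfV _ p) ?gt_eqF// powRrM pnorm.unlock.
apply: ge0_ler_powR; rewrite ?nnegrE ?powR_ge0 ?fine_psum_ge0 ?invr_ge0 ?(ltW p0)//.
rewrite -lee_fin psum_fine// psum.unlock.
by apply: (@esum_ge _ _ _ _ _); exists [set t]; rewrite ?fsbig_set1.
Qed.

Lemma pnorm_fst (T : choiceType) (C : finType) p (x : T -> R) : 0 < p -> lp p x ->
  pnorm p (fun t : T * C => x t.1) = #|C|%:R `^ p^-1 * pnorm p x.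
Proof.
move=> p0 xp; rewrite !pnorm.unlock psum_fst -psum_fine// -EFinM /=.
by rewrite powRM ?fine_psum_ge0.
Qed.

Lemma lp_fst (T : choiceType) (C : finType) p (x : T -> R) : lp p x ->
  lp p (fun t : T * C => x t.1).
Proof.
by move=> xp; rewrite /lp psum_fst -psum_fine// -EFinM ltry.
Qed.

End more_lp.

Section psum_bounds.
Context (R : realType).

Lemma psum_supp (T : choiceType) (p B : R) (L : seq T) (x : T -> R) : 0 < p ->
  (forall t, x t != 0 -> t \in L) -> (forall t, `|x t| <= B) ->
  (psum p x <= ((size L)%:R * B `^ p)%:E)%E.
Proof.
move=> p0 xL xB; rewrite psum.unlock.
have -> : (\esum_(t in [set: T]) (`|x t| `^ p)%:E = \esum_(t in [set` undup L]) (`|x t| `^ p)%:E)%E.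
  rewrite [RHS]esum_mkcond; apply: eq_esum => t _.
  rewrite mem_setE mem_undup; case: ifPn => // /negP tL.
  have [->|/xL //] := eqVneq (x t) 0; by rewrite normr0 powR0// gt_eqF.
rewrite esum_fset; last 2 first.
- exact: finite_seq.
- by move=> t _; rewrite lee_fin powR_ge0.
rewrite -fsbig_seq ?undup_uniq// sumEFin lee_fin.
apply: (@le_trans _ _ (\sum_(t <- undup L) B `^ p)).
  by apply: ler_sum => t _; rewrite ge0_ler_powR ?nnegrE ?(ltW p0)// (le_trans _ (xB t)).
rewrite big_const_seq count_predT iter_addr_0 -[_ *+ size _]mulr_natl.
by rewrite ler_wpM2r ?powR_ge0// ler_nat size_undup.
Qed.

Lemma psum_ge (T : choiceType) (p B : R) (L : seq T) (x : T -> R) : 0 < p -> 0 <= B ->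
  uniq L -> (forall t, t \in L -> B <= `|x t|) ->
  (((size L)%:R * B `^ p)%:E <= psum p x)%E.
Proof.
move=> p0 B0 uL xB; rewrite psum.unlock.
apply: (@le_trans _ _ (\sum_(t <- L) (`|x t| `^ p)%:E)%E).
  rewrite sumEFin lee_fin -[size L]count_predT mulr_natl -iter_addr_0 -big_const_seq.
  rewrite big_seq [leRHS]big_seq; apply: ler_sum => t tL.
  by rewrite ge0_ler_powR ?nnegrE ?(ltW p0)// xB.
rewrite fsbig_seq//; apply: ereal_sup_ubound; exists [set` L] => //.
Qed.

Lemma psum_natpair_le (T : choiceType) (p B : R) (x : nat * T -> R) (c : nat -> R) :
  (forall k, (psum p (fun t => x (k, t)) <= (c k)%:E)%E) ->
  (forall N, \sum_(k < N) c k <= B) -> (psum p x <= B%:E)%E.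
Proof.
move=> xc cB; have c0 k : 0 <= c k by rewrite -lee_fin; exact: le_trans (psum_ge0 _ _) (xc k).
rewrite psum_pair; apply: (@le_trans _ _ (\esum_(k in [set: nat]) (c k)%:E)%E).
  by apply: le_esum => k _; exact: xc.
rewrite -nneseries_esumT; last by move=> k; rewrite lee_fin.
apply: lime_le; first by apply: is_cvg_nneseries => n _ _; rewrite lee_fin.
by apply: nearW => N; rewrite big_mkord sumEFin lee_fin.
Qed.

(** By induction, the sum and the next term are both at most [r ^+ m], and twice that is at most
    [r ^+ m.+1]. No factor depending on r appears. *)
Lemma sum_geom_ge2 (r : R) m : 2 <= r -> \sum_(k < m) r ^+ k <= r ^+ m.
Proof.
move=> r2; elim: m => [|m IH]; first by rewrite big_ord0 expr0.
rewrite big_ord_recr /= exprS; apply: le_trans (lerD IH (lexx _)) _.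
have : 0 <= r ^+ m by rewrite exprn_ge0// (le_trans _ r2).
move: (r ^+ m) => u u0; nra.
Qed.

Lemma sum_geom_lt1 (s : R) N : 0 < s < 1 -> \sum_(k < N) s ^+ k <= (1 - s)^-1.
Proof.
move=> /andP[s0 s1]; have := @geometric_le_lim R N 1 s ler01 s0.
rewrite gtr0_norm// => /(_ s1); rewrite mul1r /series /= big_mkord.
by rewrite (eq_bigr (fun i : 'I_N => s ^+ i)) => [//|i _]; rewrite mul1r.
Qed.

Lemma powR2_gt1 (x : R) : 0 < x -> 1 < 2 `^ x.
Proof.
move=> x0; have : (1 : R) `^ x < 2 `^ x by rewrite gt0_ltr_powR ?nnegrE ?ltr1n.
by rewrite powR1.
Qed.

Lemma powR2N_lt1 (x : R) : 0 < x -> 2 `^ (- x) < 1.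
Proof. by move=> x0; rewrite powRN invf_lt1 ?powR_gt0 ?powR2_gt1. Qed.

(* Young's inequality between 1/2 and 1 with weights e and 1 - e. *)
Lemma half_powR_le (e : R) : 0 < e < 1 -> 2 `^ (- e) <= 1 - e / 2.
Proof.
move=> /andP[e0 e1]; rewrite powRN.
have := @conjugate_powR R ((2 `^ e)^-1) 1 e^-1 (1 - e)^-1.
rewrite invr_ge0 powR_ge0 ler01 !invrK !invr_gt0 subr_gt0 subrKC => /(_ isT isT e0 e1 erefl).
rewrite mulr1 powR1 mul1r -powRN -powRrM mulNr mulfV ?gt_eqF// powR_inv1// => /le_trans; apply.
lra.
Qed.

End psum_bounds.

(** * l_p embeds isometrically in L_p([0, 1]) *)

Section emb.
Context (R : realType) (p : R) (p1 : (1 <= p%:E)%E).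

Lemma Lnorm_ae_eq d (T : measurableType d) (mu : {measure set T -> \bar R}) (q : R) (f g : T -> R) :
  measurable_fun setT f -> measurable_fun setT g -> ae_eq mu setT f g ->
  Lnorm mu q%:E (EFin \o f) = Lnorm mu q%:E (EFin \o g).
Proof.
move=> mf mg fg; rewrite Lnorm.unlock; congr (_ `^ _)%E.
have mm (h : T -> R) : measurable_fun setT h ->
    measurable_fun setT ((EFin \o (fun x => `|h x| `^ q)) : T -> \bar R).
  move=> mh; apply/measurable_EFinP.
  apply: (@measurableT_comp _ _ _ _ _ _ (fun y : R => y `^ q)%R) => //.
  exact: measurableT_comp.
apply: ae_eq_integral => //; try exact: mm.
by apply: filterS fg => x /= h _; rewrite h.
Qed.

Local Notation mfun01 :=
  {mfun_ (leb01 R), measurableTypeR R >-> measurableTypeR R}.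

(** Elements of [Lp01] are classes of functions; the representative chosen in the class of [f]
    agrees with [f] only almost everywhere. *)
Lemma Lp01_repr (f : R -> R) :
  measurable_fun [set: measurableTypeR R] (f : _ -> measurableTypeR R) ->
  finite_norm (leb01 R) p%:E f ->
  exists F : Lp01 p1, ae_eq (leb01 R) setT (F : R -> R) f.
Proof.
move=> mf ff.
pose fm : {mfun measurableTypeR R >-> measurableTypeR R} :=
  HB.pack f (@isMeasurableFun.Build _ _ _ _ _ mf).
pose g : mfun01 := (\pi_mfun01 fm)%qT.
have gf : ae_eq (leb01 R) setT (g : R -> R) f.
  have : repr g = fm %[mod mfun01]%qT by rewrite reprK.
  move=> /eqmodP/asboolP; apply: filterS => x /= h _; exact: h.
have gp : finite_norm (leb01 R) p%:E g.
  rewrite /finite_norm (Lnorm_ae_eq _ _ _ gf)//; exact: (measurable_funPT (repr g)).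
by exists (LebesgueSpace.Pack (LebesgueSpace.Class (@isFinLebesgue.Axioms_ _ _ _ _ _ p1 g gp))).
Qed.

Lemma Lp_dist_ae (F G : Lp01 p1) (f g : R -> R) :
  measurable_fun setT f -> measurable_fun setT g ->
  ae_eq (leb01 R) setT (F : R -> R) f -> ae_eq (leb01 R) setT (G : R -> R) g ->
  Lp_dist F G = fine (Lnorm (leb01 R) p%:E (fun t => (f t - g t)%:E)).
Proof.
move=> mf mg Ff Gg; rewrite /Lp_dist; congr fine.
have mL (H : Lp01 p1) : measurable_fun [set: R] (H : R -> R).
  exact: (measurable_funPT (repr (LebesgueSpace.sort H))).
apply: (@Lnorm_ae_eq _ _ _ p (fun t => F t - G t) (fun t => f t - g t)).
- exact: (measurable_funB (mL F) (mL G)).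
- exact: measurable_funB.
- by apply: filterS2 Ff Gg => t h1 h2 _; rewrite h1// h2.
Qed.

Definition dyad (n : nat) : set R := `]2^-1 ^+ n.+1, 2^-1 ^+ n].

Lemma dyad_inj (m n : nat) (t : R) : dyad m t -> dyad n t -> m = n.
Proof.
have aux (i j : nat) : (i < j)%N -> dyad i t -> dyad j t -> False.
  rewrite /dyad /= !in_itv /= => ij /andP[ti _] /andP[_ tj].
  have := lt_le_trans ti tj; apply/negP; rewrite -leNgt.
  by apply: ler_wiXn2l => //; rewrite ?invr_ge0 ?invf_le1 ?ler1n.
move=> tm tn; case: (ltngtP m n) => // h; first by case: (aux _ _ h tm tn).
by case: (aux _ _ h tn tm).
Qed.

Lemma measurable_dyad n : measurable (dyad n : set (measurableTypeR R)).
Proof. exact: measurable_itv. Qed.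

Lemma bigcup_dyad : \bigcup_n dyad n = `]0, 1]%classic.
Proof.
apply/seteqP; split => t /=.
  move=> [n _]; rewrite /dyad /= !in_itv /= => /andP[t0 t1]; apply/andP; split.
    by apply: le_lt_trans t0; rewrite exprn_ge0// invr_ge0.
  by apply: le_trans t1 _; rewrite exprn_ile1// ?invr_ge0// invf_le1// ler1n.
rewrite in_itv /= => /andP[t0 t1].
have ex : exists n, (2^-1 : R) ^+ n < t.
  exists (Num.truncn t^-1).+1; rewrite exprVn invf_plt ?posrE ?exprn_gt0//.
  apply: lt_trans (truncnS_gt _) _.
  by rewrite -natrX ltr_nat ltn_expl.
case: (ex_minnP ex) => -[|n] tn nmin; first by move: tn; rewrite expr0 ltNge t1.
exists n => //; rewrite /dyad /= in_itv /= tn /= leNgt; apply/negP => h.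
by have := nmin _ h; rewrite ltnn.
Qed.

Lemma leb01_dyad n : leb01 R (dyad n) = ((2^-1) ^+ n.+1)%:E.
Proof.
rewrite -[LHS]/(lebesgue_measure (dyad n `&` `[0, 1]%classic)) setIidl; last first.
  apply: (@subset_trans _ (`]0, 1]%classic : set R)).
    by rewrite -bigcup_dyad; exact: bigcup_sup.
  by move=> t /=; rewrite !in_itv /= => /andP[/ltW -> ->].
rewrite /dyad lebesgue_measure_itv /= lte_fin -EFinB.
rewrite ifT; last by rewrite exprS gtr_pMl ?exprn_gt0 ?invr_gt0// invf_lt1// ltr1n.
by congr EFin; rewrite exprS; field.
Qed.

(** As [dyad n] has measure 2^-(n+1), the factor 2^((n+1)/p) makes the integral of the p-th power
    over it equal to |x n|^p. *)
Definition dyad_step (x : nat -> R) (t : R) : R :=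
  if t \in (`]0, 1]%classic : set R) then
    let n := xget 0%N [set n | dyad n t] in (2 ^+ n.+1) `^ p^-1 * x n
  else 0.

Lemma dyad_stepE x n t : dyad n t -> dyad_step x t = (2 ^+ n.+1) `^ p^-1 * x n.
Proof.
move=> tn; rewrite /dyad_step ifT; last by rewrite inE -bigcup_dyad; exists n.
have -> // : xget 0%N [set n | dyad n t] = n.
by apply: xget_unique => // m /(dyad_inj tn).
Qed.

Lemma dyad_step0 x t : (~` `]0, 1]%classic) t -> dyad_step x t = 0.
Proof. by move=> tn; rewrite /dyad_step memNset. Qed.

Lemma measurable_dyad_step x :
  measurable_fun [set: measurableTypeR R] (dyad_step x : _ -> measurableTypeR R).
Proof.
have mI : measurable (`]0, 1]%classic : set (measurableTypeR R)) by exact: measurable_itv.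
rewrite -(setUv (`]0, 1]%classic : set (measurableTypeR R))).
apply/measurable_funU => //; first exact: measurableC.
split.
  rewrite -bigcup_dyad; apply/measurable_fun_bigcup; first exact: measurable_dyad.
  move=> n; apply: (@eq_measurable_fun _ _ _ _ _ (cst ((2 ^+ n.+1) `^ p^-1 * x n))).
    by move=> t; rewrite inE => /dyad_stepE ->.
  exact: measurable_cst.
apply: (@eq_measurable_fun _ _ _ _ _ (cst (0 : R))).
  by move=> t; rewrite inE => /dyad_step0 ->.
exact: measurable_cst.
Qed.

Let p0 : 0 < p.
Proof. by move: p1; rewrite lee_fin; exact: lt_le_trans. Qed.

Lemma integral_dyad_step x : (\int[leb01 R]_t (`|dyad_step x t| `^ p)%:E)%E = psum p x.
Proof.
have mI : measurable (`]0, 1]%classic : set (measurableTypeR R)) by exact: measurable_itv.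
have ms D : measurable D ->
    measurable_fun (D : set (measurableTypeR R)) (fun t => (`|dyad_step x t| `^ p)%:E : \bar R).
  move=> mD; apply: (@measurable_funS _ _ _ _ setT) => //.
  apply/measurable_EFinP.
  apply: (@measurableT_comp _ _ _ _ _ _ (fun y : R => y `^ p)%R) => //.
  by apply: measurableT_comp => //; exact: measurable_dyad_step.
have s0 t : (0 <= (`|dyad_step x t| `^ p)%:E)%E by rewrite lee_fin powR_ge0.
rewrite -(setUv (`]0, 1]%classic : set (measurableTypeR R))) ge0_integral_setU//; last 3 first.
- exact: measurableC.
- by rewrite setUv; exact: ms.
- by apply/disj_setPCl.
rewrite [X in (_ + X)%E]null_set_integral ?adde0; last 3 first.
- exact: measurableC.
- by apply: ms; exact: measurableC.
(* Within [0, 1], the complement of ]0, 1] is the point 0. *)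
- rewrite -[LHS]/(lebesgue_measure (~` `]0, 1]%classic `&` `[0, 1]%classic)).
  have -> : ~` `]0, 1]%classic `&` `[0, 1]%classic = [set (0 : R)].
    apply/seteqP; split => t /=; rewrite !in_itv /=.
      move=> [/negP + /andP[t0 t1]]; rewrite t1 andbT -leNgt => t0'.
      by apply/eqP; rewrite eq_le t0'.
    by move=> ->; rewrite ltxx lexx ler01; split.
  exact: lebesgue_measure_set1.
rewrite -bigcup_dyad ge0_integral_bigcup//; last 3 first.
- exact: measurable_dyad.
- by apply: ms; rewrite bigcup_dyad.
- apply/trivIsetP => i j _ _ ij; apply/seteqP; split => // t [/dyad_inj h /h /eqP].
  by rewrite (negbTE ij).
rewrite psum_series; apply: eq_eseriesr => n _.
rewrite (eq_integral (cst (2 ^+ n.+1 * `|x n| `^ p)%:E)); last first.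
  move=> t; rewrite inE => /dyad_stepE ->; rewrite normrM powRM// ger0_norm ?powR_ge0//.
  by rewrite -powRrM mulVf ?gt_eqF// powRr1// exprn_ge0.
rewrite integral_cst; last exact: measurable_dyad.
rewrite [X in (_ * X)%E]leb01_dyad -EFinM mulrAC -exprMn mulfV// expr1n mul1r //.
Qed.

Lemma Lnorm_dyad_step x : Lnorm (leb01 R) p%:E (EFin \o dyad_step x) = (psum p x `^ p^-1)%E.
Proof. by rewrite unlock -integral_dyad_step. Qed.

Lemma dyad_stepB (T : countType) (x y : T -> R) t :
  dyad_step (nat_lift x) t - dyad_step (nat_lift y) t = dyad_step (nat_lift (fun i => x i - y i)) t.
Proof.
rewrite /dyad_step; case: ifP => _; last by rewrite subr0.
rewrite -mulrBr /nat_lift; congr (_ * _); case: pickle_inv => //=.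
by rewrite subr0.
Qed.

(** [dyad_step] respects differences and preserves p-th power sums, hence distances. The value of
    [E] outside l_p is irrelevant. *)
Lemma lp_Lp01 (T : countType) : exists E : (T -> R) -> Lp01 p1,
  forall x y, lp p x -> lp p y -> Lp_dist (E x) (E y) = pnorm p (fun t => x t - y t).
Proof.
have pn0 : p != 0 by rewrite gt_eqF.
have ex (x : T -> R) : exists F : Lp01 p1,
    lp p x -> ae_eq (leb01 R) setT (F : R -> R) (dyad_step (nat_lift x)).
  have [xp|xp] := pselect (lp p x).
    have [|F Fx] := @Lp01_repr _ (measurable_dyad_step (nat_lift x)); last by exists F.
    rewrite /finite_norm Lnorm_dyad_step poweR_lty// -psum_nat_lift//.
  have [|F _] := @Lp01_repr _ (measurable_dyad_step (fun=> 0)); last by exists F.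
  rewrite /finite_norm Lnorm_dyad_step poweR_lty// psum.unlock esum1// => t _.
  by rewrite normr0 powR0.
have [E EP] := choice ex; exists E => x y xp yp.
rewrite (Lp_dist_ae (measurable_dyad_step _) (measurable_dyad_step _) (EP _ xp) (EP _ yp)).
set u := (fun t => _%:E).
have -> : u = EFin \o dyad_step (nat_lift (fun i => x i - y i)).
  by apply/funext => t; rewrite /u /= dyad_stepB.
by rewrite Lnorm_dyad_step -psum_nat_lift// fine_poweR pnorm.unlock.
Qed.
End emb.

(** * Coordinates on the Heisenberg group *)

Local Open Scope quotient_scope.

(* (x, y, z) is the upper unitriangular matrix with x and y next to the diagonal
   and z in the corner; it is b^y a^x c^z for c = [a, b]. *)
Definition hz : Type := (int * int * int)%type.

Definition hz1 : hz := (0, 0, 0).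
Definition hzmul (g h : hz) : hz :=
  (g.1.1 + h.1.1, g.1.2 + h.1.2, g.2 + h.2 + g.1.1 * h.1.2).
Definition hzinv (g : hz) : hz :=
  (- g.1.1, - g.1.2, - g.2 + g.1.1 * g.1.2).

Lemma hzmulA : associative hzmul.
Proof.
by move=> [[x y] z] [[x1 y1] z1] [[x2 y2] z2]; rewrite /hzmul /=; congr (_, _, _); ring.
Qed.

Lemma hzmul1 : left_id hz1 hzmul.
Proof.
by move=> [[x y] z]; rewrite /hzmul /=; congr (_, _, _); ring.
Qed.

Lemma hzmulr1 : right_id hz1 hzmul.
Proof.
by move=> [[x y] z]; rewrite /hzmul /=; congr (_, _, _); ring.
Qed.

Lemma hzmulV : left_inverse hz1 hzinv hzmul.
Proof.
by move=> [[x y] z]; rewrite /hzmul /hzinv /hz1 /=; congr (_, _, _); ring.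
Qed.

Lemma hzmulrV : right_inverse hz1 hzinv hzmul.
Proof.
by move=> [[x y] z]; rewrite /hzmul /hzinv /hz1 /=; congr (_, _, _); ring.
Qed.

Lemma hzmulK g : cancel (hzmul g) (hzmul (hzinv g)).
Proof. by move=> h; rewrite hzmulA hzmulV hzmul1. Qed.

Lemma hzmulVK g : cancel (hzmul (hzinv g)) (hzmul g).
Proof. by move=> h; rewrite hzmulA hzmulrV hzmul1. Qed.

Lemma hzinvM g h : hzinv (hzmul g h) = hzmul (hzinv h) (hzinv g).
Proof.
by case: g h => [[x y] z] [[x1 y1] z1]; rewrite /hzmul /hzinv /=; congr (_, _, _); ring.
Qed.

Lemma hzinvK : involutive hzinv.
Proof.
by move=> [[x y] z]; rewrite /hzinv /=; congr (_, _, _); ring.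
Qed.

Definition letter_coord (l : letter) : hz :=
  let e : int := if l.2 then -1 else 1 in if l.1 then (0, e, 0) else (e, 0, 0).

Definition word_coord (w : word) : hz :=
  foldr (fun l g => hzmul (letter_coord l) g) hz1 w.

Lemma word_coord_cat v w :
  word_coord (v ++ w) = hzmul (word_coord v) (word_coord w).
Proof. by elim: v => [|l v IH] /=; rewrite ?hzmul1// IH hzmulA. Qed.

(** The defining relations hold for matrices: [word_comm] has coordinates (0, 0, 1), which commute
    with everything. *)
Lemma word_coord_rel v w : heis_rel v w -> word_coord v = word_coord w.
Proof.
elim=> {v w} [//|v w _ -> //|u v w _ -> _ -> //|v v' w w' _ IHv _ IHw||w].
- by rewrite !word_coord_cat IHv IHw.
- by move=> [[] []].
- rewrite !word_coord_cat; case: (word_coord w) => [[x y] z].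
  by rewrite /hzmul /=; congr (_, _, _); ring.
Qed.

Definition coord (x : heis) : hz := word_coord (repr x).

Lemma coord_pi w : coord (\pi_heis w) = word_coord w.
Proof. exact/word_coord_rel/heis_rel_repr. Qed.

Lemma coordM x y : coord (x * y)%g = hzmul (coord x) (coord y).
Proof. by rewrite -word_coord_cat -coord_pi. Qed.

Lemma coord1 : coord 1%g = hz1.
Proof. exact: coord_pi. Qed.

Lemma coordV x : coord x^-1%g = hzinv (coord x).
Proof.
rewrite -[LHS]hzmul1 -(hzmulV (coord x)) -hzmulA -coordM.
by rewrite (mulgV x) coord1 hzmulr1.
Qed.

Definition heis_c : heis := (heis_a * heis_b * heis_a^-1 * heis_b^-1)%g.

Lemma heis_cE : heis_c = \pi_heis word_comm.
Proof.
rewrite /heis_c.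
have -> : heis_a^-1%g = \pi_heis (word_inv word_a) by exact: heis_invE.
have -> : heis_b^-1%g = \pi_heis (word_inv word_b) by exact: heis_invE.
by rewrite /heis_a /heis_b; rewrite -[LHS]/(heis_mul (heis_mul (heis_mul _ _) _) _) !heis_mulE.
Qed.

Lemma heis_c_central x : commute heis_c x.
Proof.
rewrite heis_cE -[x]reprK /commute.
rewrite -[LHS]/(heis_mul _ _) -[RHS]/(heis_mul _ _) !heis_mulE.
exact/heisP/heis_rel_central.
Qed.

Section zexp.
Variable G : groupType.
Implicit Types (x y : G) (n : int).

Definition zexp x (n : int) : G :=
  match n with Posz n => (x ^+ n)%g | Negz n => (x ^- n.+1)%g end.

Lemma zexpS x n : zexp x (1 + n) = (x * zexp x n)%g.
Proof.
case: n => [n|[|n]].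
- by rewrite -PoszD add1n /= expgS.
- by rewrite /= mulgV.
- have -> : 1 + Negz n.+1 = Negz n by rewrite !NegzE; lia.
  by rewrite /= [in RHS]expgSr invgM mulgA mulgV mul1g.
Qed.

Lemma zexpP x n : zexp x (-1 + n) = (x^-1 * zexp x n)%g.
Proof. by have := zexpS x (-1 + n); rewrite addNKr => ->; rewrite mulgA mulVg mul1g. Qed.

Lemma int_ind_step (P : int -> Prop) : P 0 -> (forall n, P n -> P (1 + n)) ->
  (forall n, P n -> P (-1 + n)) -> forall n, P n.
Proof.
move=> P0 PS PP; elim/int_ind => // n Pn; rewrite ?intS ?opprD; first exact: PS.
exact: PP.
Qed.

Lemma zexp_conj x y n : (zexp x n ^ y)%g = zexp (x ^ y)%g n.
Proof. by case: n => n /=; rewrite ?conjVg conjXg. Qed.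

Lemma zexpM x y n : commute x y -> zexp (x * y)%g n = (zexp x n * zexp y n)%g.
Proof.
move=> xy; case: n => n /=; rewrite expgMn// invgM.
by rewrite -!expVgn; apply: commuteX2; apply/commuteV/commute_sym/commuteV.
Qed.

Lemma commute_zexp x y n : commute x y -> commute x (zexp y n).
Proof.
by move=> xy; case: n => n; [apply: commuteX|apply: commuteV; apply: commuteX].
Qed.

Lemma zexpN x n : zexp x (- n) = (zexp x n)^-1%g.
Proof.
elim/int_ind_step: n => [|n IH|n IH]; first by rewrite oppr0 invg1.
  rewrite opprD zexpP IH zexpS invgM.
  apply: commuteV; apply: commute_sym; apply/commuteV/commute_sym/commute_zexp.
  exact: commute_refl.
rewrite opprD opprK zexpS IH zexpP invgM invgK.
by apply: commuteV; apply: commute_zexp; exact: commute_refl.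
Qed.

Lemma zexpD x m n : zexp x (m + n) = (zexp x m * zexp x n)%g.
Proof.
elim/int_ind_step: m => [|m IH|m IH]; first by rewrite add0r mul1g.
  by rewrite -addrA !zexpS IH mulgA.
by rewrite -addrA !zexpP IH mulgA.
Qed.

End zexp.

Definition heis_nf (g : hz) : heis :=
  (zexp heis_b g.1.2 * zexp heis_a g.1.1 * zexp heis_c g.2)%g.

(** Conjugation by a turns b into c b; as c is central, it turns b^y into c^y b^y. *)
Lemma heis_ab y :
  (heis_a * zexp heis_b y = zexp heis_c y * (zexp heis_b y * heis_a))%g.
Proof.
rewrite [LHS]conjgCV zexp_conj.
have -> : (heis_b ^ heis_a^-1)%g = (heis_c * heis_b)%g.
  by rewrite conjgE /heis_c invgK -!mulgA mulVg mulg1.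
by rewrite zexpM ?mulgA//; exact: heis_c_central.
Qed.

Lemma zexpc_central z x : commute (zexp heis_c z) x.
Proof. by apply/commute_sym/commute_zexp/commute_sym/heis_c_central. Qed.

Lemma heis_aVb y :
  (heis_a^-1 * zexp heis_b y = zexp heis_c (- y) * (zexp heis_b y * heis_a^-1))%g.
Proof.
apply: (mulgI heis_a); rewrite mulgA mulgV mul1g.
rewrite mulgA -(zexpc_central _ heis_a) -!mulgA (mulgA heis_a) heis_ab.
by rewrite -!mulgA mulgV mulg1 zexpN mulgA mulVg mul1g.
Qed.

(** Moving the letter a past b^y creates c^y, which is the twisted term of [hzmul]. *)
Lemma heis_nf_letter l g :
  heis_nf (hzmul (letter_coord l) g) = (\pi_heis [:: l] * heis_nf g)%g.
Proof.
have aV : \pi_heis [:: (false, true)] = heis_a^-1%g by symmetry; exact: heis_invE.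
have bV : \pi_heis [:: (true, true)] = heis_b^-1%g by symmetry; exact: heis_invE.
case: g => [[x y] z]; case: l => [[] []]; rewrite /heis_nf /hzmul /=.
- by rewrite bV !add0r mul0r addr0 zexpP !mulgA.
- by rewrite !add0r mul0r addr0 zexpS !mulgA.
- rewrite aV !add0r mulN1r zexpP !mulgA heis_aVb zexpD.
  rewrite -(mulgA (zexp heis_c _)) -(mulgA (zexp heis_c _)) [RHS]zexpc_central -!mulgA.
  by do 3 congr (_ * _)%g.
- rewrite !add0r mul1r zexpS !mulgA heis_ab zexpD.
  rewrite -(mulgA (zexp heis_c _)) -(mulgA (zexp heis_c _)) [RHS]zexpc_central -!mulgA.
  by do 3 congr (_ * _)%g.
Qed.

(** Rebuilding a word letter by letter from its matrix recovers the element, so the matrix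
    representation is faithful: the given relations imply all the others. *)
Lemma coordK : cancel coord heis_nf.
Proof.
move=> x; rewrite -[x in RHS]reprK /coord; elim: (repr x) => [|l w IH] /=.
  by rewrite /heis_nf /= !mulg1.
by rewrite heis_nf_letter IH; exact: heis_mulE.
Qed.

Lemma coord_inj : injective coord.
Proof. exact: can_inj coordK. Qed.

Lemma coord_zexp_a n : coord (zexp heis_a n) = (n, 0, 0).
Proof.
have ca : coord heis_a = (1, 0, 0) by rewrite coord_pi.
elim/int_ind_step: n => [|n IH|n IH]; first exact: coord1.
  by rewrite zexpS coordM IH ca /hzmul /=; congr (_, _, _); ring.
by rewrite zexpP coordM IH coordV ca /hzmul /hzinv /=; congr (_, _, _); ring.
Qed.

Lemma coord_zexp_b n : coord (zexp heis_b n) = (0, n, 0).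
Proof.
have cb : coord heis_b = (0, 1, 0) by rewrite coord_pi.
elim/int_ind_step: n => [|n IH|n IH]; first exact: coord1.
  by rewrite zexpS coordM IH cb /hzmul /=; congr (_, _, _); ring.
by rewrite zexpP coordM IH coordV cb /hzmul /hzinv /=; congr (_, _, _); ring.
Qed.

Lemma coord_zexp_c n : coord (zexp heis_c n) = (0, 0, n).
Proof.
have cc : coord heis_c = (0, 0, 1) by rewrite heis_cE coord_pi.
elim/int_ind_step: n => [|n IH|n IH]; first exact: coord1.
  by rewrite zexpS coordM IH cc /hzmul /=; congr (_, _, _); ring.
by rewrite zexpP coordM IH coordV cc /hzmul /hzinv /=; congr (_, _, _); ring.
Qed.

Lemma heis_nfK : cancel heis_nf coord.
Proof.
case=> [[x y] z]; rewrite /heis_nf !coordM coord_zexp_a coord_zexp_b coord_zexp_c.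
by rewrite /hzmul /=; congr (_, _, _); ring.
Qed.

(** * Word length and the homogeneous gauge *)

Lemma heis_normP x : heis_word_length x (heis_norm x).
Proof. by rewrite /heis_norm; case: ex_minnP => n /asboolP. Qed.

Lemma heis_norm_le x n : heis_word_length x n -> (heis_norm x <= n)%N.
Proof. by move=> xn; rewrite /heis_norm; case: ex_minnP => m _; apply; exact/asboolP. Qed.

Lemma heis_normM x y : (heis_norm (x * y)%g <= heis_norm x + heis_norm y)%N.
Proof.
have [[s [sn sg xs]] [t [tn tg yt]]] := (heis_normP x, heis_normP y).
apply: heis_norm_le; exists (s ++ t); split.
- by rewrite size_cat sn tn.
- by rewrite all_cat sg.
- by rewrite big_cat /= -xs -yt.
Qed.

Lemma heis_norm1 : heis_norm 1%g = 0%N.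
Proof.
apply/eqP; rewrite -leqn0; apply: heis_norm_le; exists [::]; split => //.
by rewrite big_nil.
Qed.

Lemma heis_norm_gen x : x \in heis_gens -> (heis_norm x <= 1)%N.
Proof.
move=> xg; apply: heis_norm_le; exists [:: x]; split => //=; first by rewrite xg.
by rewrite big_seq1.
Qed.

Lemma heis_norm_zexp x n : x \in heis_gens -> x^-1%g \in heis_gens ->
  (heis_norm (zexp x n) <= `|n|)%N.
Proof.
move=> xg xVg.
have X y m : y \in heis_gens -> (heis_norm (y ^+ m)%g <= m)%N.
  move=> yg; elim: m => [|m IH]; first by rewrite heis_norm1.
  rewrite expgS; apply: leq_trans (heis_normM _ _) _.
  by rewrite -add1n leq_add// heis_norm_gen.
by case: n => n /=; rewrite ?NegzE ?abszN ?absz_nat -?expVgn X.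
Qed.

(* The gauge takes natural values, so that the functions [bump] below are
   integer valued and can be composed with a snowflake embedding of int. *)
Definition hz_fits (g : hz) (n : nat) : bool :=
  [&& `|g.1.1| <= n, `|g.1.2| <= n & `|g.2| <= n ^ 2]%N.

Lemma hz_fits_ex g : exists n, hz_fits g n.
Proof.
exists (`|g.1.1| + `|g.1.2| + `|g.2|)%N; apply/and3P; split; [lia|lia|].
by nia.
Qed.

Definition gauge (g : hz) : nat := ex_minn (hz_fits_ex g).

Lemma gauge_fits g : hz_fits g (gauge g).
Proof. by rewrite /gauge; case: ex_minnP. Qed.

Lemma gauge_le g n : (gauge g <= n)%N = hz_fits g n.
Proof.
apply/idP/idP => [|gn]; last by rewrite /gauge; case: ex_minnP => m _; apply.
move=> gn; have /and3P[x y z] := gauge_fits g.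
apply/and3P; split; [exact: leq_trans gn|exact: leq_trans gn|].
by apply: leq_trans z _; rewrite leq_exp2r.
Qed.

(** The twisted term is at most m n, and m^2 + n^2 + m n <= (m + n)^2, so the triangle inequality
    holds without a constant. *)
Lemma gaugeM g h : (gauge (hzmul g h) <= gauge g + gauge h)%N.
Proof.
rewrite gauge_le; have := gauge_fits g; have := gauge_fits h.
case: g h => [[x y] z] [[x1 y1] z1]; move: (gauge _) (gauge _) => m n.
rewrite /hz_fits /= => /and3P[x1m y1m z1m] /and3P[xn yn zn].
apply/and3P; split; [lia|lia|].
have : (`|(x * y1)%R| <= m * n)%N by rewrite abszM leq_mul.
move: (x * y1)%R => u; nia.
Qed.

(** The gauge is not symmetric: inversion brings in x y, and n^2 + n^2 <= (2 n)^2. *)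
Lemma gaugeV g : (gauge (hzinv g) <= 2 * gauge g)%N.
Proof.
rewrite gauge_le; have := gauge_fits g.
case: g => [[x y] z]; move: (gauge _) => n.
rewrite /hz_fits /= => /and3P[xn yn zn].
apply/and3P; split; [lia|lia|].
have : (`|(x * y)%R| <= n * n)%N by rewrite abszM leq_mul.
move: (x * y) => u; nia.
Qed.

Definition dilate (g : hz) : hz := (2 * g.1.1, 2 * g.1.2, 4 * g.2).

Lemma dilateM g h : dilate (hzmul g h) = hzmul (dilate g) (dilate h).
Proof.
by case: g h => [[x y] z] [[x1 y1] z1]; rewrite /hzmul /dilate /=; congr (_, _, _); ring.
Qed.

Lemma dilateV g : dilate (hzinv g) = hzinv (dilate g).
Proof.
by case: g => [[x y] z]; rewrite /hzinv /dilate /=; congr (_, _, _); ring.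
Qed.

Lemma gauge_dilate_le g : (gauge (dilate g) <= 2 * gauge g)%N.
Proof.
rewrite gauge_le; have := gauge_fits g.
case: g => [[x y] z]; move: (gauge _) => n.
by rewrite /hz_fits /= => /and3P[xn yn zn]; apply/and3P; split; [lia|lia|nia].
Qed.

(** The loss of 1 comes from rounding half of an integer gauge up to [uphalf]. *)
Lemma gauge_dilate_ge g : (2 * gauge g <= gauge (dilate g) + 1)%N.
Proof.
suff : (gauge g <= uphalf (gauge (dilate g)))%N.
  by have := uphalfK (gauge (dilate g)); case: (odd _); lia.
rewrite gauge_le; have := gauge_fits (dilate g).
case: g => [[x y] z]; move: (gauge _) => n.
have : (n <= 2 * uphalf n)%N by have := uphalfK n; case: (odd _); lia.
move: (uphalf n) => m.
by rewrite /hz_fits /= => nm /and3P[xn yn zn]; apply/and3P; split; [lia|lia|nia].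
Qed.

Lemma gauge_coord_le x : (gauge (coord x) <= heis_norm x)%N.
Proof.
have [s [<- sg ->]] := heis_normP x.
elim: s sg => [|g s IH] /=; first by rewrite big_nil coord1 gauge_le.
move=> /andP[gg /IH {}IH]; rewrite big_cons coordM.
apply: leq_trans (gaugeM _ _) _; rewrite -add1n leq_add// gauge_le.
by move: gg; rewrite !inE => /or4P[] /eqP ->; rewrite ?coordV coord_pi.
Qed.

(** The commutator of a^m and b^n is c^(m n). Writing |z| = m^2 + r with r <= 2 m, the product of
    [a^m, b^m] and [a^r, b], with the sign of z put on the powers of a, has length at most 4 m + 2 r
    + 2 <= 8 m + 2. *)
Lemma heis_norm_center z :
  exists2 x, coord x = (0, 0, z) & forall n : nat, (`|z| <= n ^ 2 -> heis_norm x <= 8 * n + 2)%N.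
Proof.
pose comm (m n : int) : heis :=
  (zexp heis_a m * zexp heis_b n * zexp heis_a (- m) * zexp heis_b (- n))%g.
have ccomm m n : coord (comm m n) = (0, 0, m * n).
  rewrite !coordM !coord_zexp_a !coord_zexp_b /hzmul /=.
  by congr (_, _, _); ring.
have ncomm m n : (heis_norm (comm m n) <= 2 * `|m| + 2 * `|n|)%N.
  have na k : (heis_norm (zexp heis_a k) <= `|k|)%N.
    by apply: heis_norm_zexp; rewrite !inE eqxx ?orbT.
  have nb k : (heis_norm (zexp heis_b k) <= `|k|)%N.
    by apply: heis_norm_zexp; rewrite !inE eqxx ?orbT.
  apply: leq_trans (heis_normM _ _) _.
  have h1 := heis_normM (zexp heis_a m) (zexp heis_b n).
  have h2 := heis_normM (zexp heis_a m * zexp heis_b n)%g (zexp heis_a (- m)).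
  apply: leq_trans (leq_add (leq_trans h2 (leq_add h1 (leqnn _))) (leqnn _)) _.
  have := (na m, nb n, na (- m), nb (- n)); rewrite !abszN => -[[[h3 h4] h5] h6]; lia.
have [m mz] : exists m, (m ^ 2 <= `|z| <= m ^ 2 + 2 * m)%N.
  have ex : exists m, (m ^ 2 <= `|z|)%N by exists 0%N.
  have ub m : (m ^ 2 <= `|z| -> m <= `|z|)%N.
    by apply: leq_trans; case: m => // m; rewrite -mulnn leq_pmulr.
  case: (ex_maxnP ex ub) => m mz mmax; exists m; rewrite mz /= leqNgt.
  apply/negP => h; suff : (m.+1 <= m)%N by rewrite ltnn.
  apply: mmax; apply: leq_trans h; rewrite -[m.+1]addn1 sqrnD; lia.
pose s : int := if 0 <= z then 1 else -1.
pose r := (`|z| - m ^ 2)%N.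
exists (comm (s * m%:Z)%R m%:Z * comm (s * r%:Z)%R 1%R)%g.
  rewrite coordM !ccomm /hzmul /=; congr (_, _, _).
  rewrite /s /r; case: ifP; nia.
move=> n zn; apply: leq_trans (heis_normM _ _) _.
have sk (k : nat) : `|(s * k%:Z)%R|%N = k by rewrite /s; case: ifP; lia.
have := ncomm (s * m%:Z) m%:Z; have := ncomm (s * r%:Z) 1; rewrite !sk absz1 absz_nat.
have mn : (m <= n)%N by rewrite -leq_sqr; lia.
have : (r <= 2 * m)%N by rewrite /r; lia.
lia.
Qed.

(** In the normal form b^y a^x c^z of an element of gauge n, the first two factors cost 2 n letters
    and the central one 8 n + 2; the sum is at most 12 n as soon as n >= 1. *)
Lemma heis_norm_le_gauge x : (heis_norm x <= 12 * gauge (coord x))%N.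
Proof.
have [x0|x0] := posnP (gauge (coord x)).
  have := gauge_fits (coord x); rewrite x0 /hz_fits => fx.
  suff -> : x = 1%g by rewrite heis_norm1.
  apply: coord_inj; rewrite coord1; case: (coord x) fx => [[a b] c] /=.
  by rewrite !leqn0 !absz_eq0 => /and3P[/eqP -> /eqP -> /eqP ->].
have := gauge_fits (coord x); rewrite /hz_fits => /and3P[].
case E : (coord x) => [[a b] c] /=; rewrite -E => an bn cn.
have [y yc yn] := heis_norm_center c.
have xE : x = (zexp heis_b b * zexp heis_a a * y)%g.
  apply: coord_inj; rewrite !coordM coord_zexp_a coord_zexp_b yc E /hzmul /=.
  by congr (_, _, _); ring.
rewrite {1}xE; apply: leq_trans (heis_normM _ _) _.
apply: leq_trans (leq_add (heis_normM _ _) (leqnn _)) _.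
have na : (heis_norm (zexp heis_a a) <= `|a|)%N.
  by apply: heis_norm_zexp; rewrite !inE eqxx ?orbT.
have nb : (heis_norm (zexp heis_b b) <= `|b|)%N.
  by apply: heis_norm_zexp; rewrite !inE eqxx ?orbT.
have := yn _ cn; lia.
Qed.

Local Close Scope quotient_scope.

(** * Packing *)

Definition irange (n : nat) : seq int := [seq i%:Z - n%:Z | i <- iota 0 n.*2.+1].

Lemma irange_uniq n : uniq (irange n).
Proof. by rewrite map_inj_uniq ?iota_uniq// => i j; lia. Qed.

Lemma mem_irange n (x : int) : (x \in irange n) = (`|x| <= n)%N.
Proof.
apply/mapP/idP => [[i]|xn]; first by rewrite mem_iota => /andP[_ +] ->; lia.
by exists `|(x + n%:Z)%R|%N; [rewrite mem_iota|]; lia.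
Qed.

Lemma size_irange n : size (irange n) = n.*2.+1.
Proof. by rewrite size_map size_iota. Qed.

Definition hz_box (n : nat) : seq hz :=
  [seq (a, z) | a <- [seq (x, y) | x <- irange n, y <- irange n], z <- irange (n ^ 2)].

Lemma hz_box_uniq n : uniq (hz_box n).
Proof.
by apply: allpairs_uniq; [apply: allpairs_uniq|..] => //;
  try exact: irange_uniq; move=> [? ?] [? ?].
Qed.

Lemma mem_hz_box n g : (g \in hz_box n) = (gauge g <= n)%N.
Proof.
rewrite gauge_le /hz_fits; case: g => [[x y] z].
apply/idP/idP => [/allpairsP[[a d] [ab zn [e ->]]]|].
  case/allpairsP: ab e => -[a' b'] [xn yn /= ->] [-> ->].
  by move: xn yn zn; rewrite !mem_irange => -> -> ->.
move=> /and3P[/= xn yn zn]; apply/allpairsP; exists ((x, y), z); rewrite mem_irange zn; split=> //.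
by apply/allpairsP; exists (x, y); rewrite !mem_irange.
Qed.

Lemma size_hz_box n : size (hz_box n) = (n.*2.+1 * n.*2.+1 * (n ^ 2).*2.+1)%N.
Proof. by rewrite !size_allpairs !size_irange. Qed.

Lemma size_hz_box_le n : (0 < n)%N -> (size (hz_box n) <= 27 * n ^ 4)%N.
Proof.
move=> n0; rewrite size_hz_box.
have h : (n.*2.+1 <= 3 * n)%N by lia.
have n2 : (0 < n ^ 2)%N by rewrite expn_gt0 n0.
have h2 : ((n ^ 2).*2.+1 <= 3 * n ^ 2)%N by lia.
apply: leq_trans (leq_mul (leq_mul h h) h2) _.
by rewrite (expnD n 2 2) -mulnn; lia.
Qed.

Lemma size_hz_box_ge n : (n ^ 4 <= size (hz_box n))%N.
Proof.
rewrite size_hz_box (expnD n 2 2) -[X in (X * _ <= _)%N]mulnn.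
by apply: leq_mul; [apply: leq_mul|]; rewrite -addnn; lia.
Qed.

(** If M > Q, Bernoulli's inequality gives (M / Q)^i >= 1 + i / Q, which exceeds A at i = A Q +
    1. *)
Lemma exp_growth (Q M A : nat) : (0 < Q)%N -> (forall i, M ^ i <= A * Q ^ i)%N -> (M <= Q)%N.
Proof.
move=> Q0 h; rewrite leqNgt; apply/negP => QM.
have k i : (Q ^ i.+1 + i.+1 * Q ^ i <= M ^ i.+1)%N.
  elim: i => [|i IH]; first by rewrite !expn1 expn0; lia.
  have := leq_mul QM IH; rewrite -(expnS M) => /(leq_trans _); apply.
  rewrite (expnS Q i.+1) (expnS Q i); move: (Q ^ i)%N => u; nia.
have := leq_trans (k (A * Q)%N) (h _); rewrite (expnS Q).
have : (0 < Q ^ (A * Q))%N by rewrite expn_gt0 Q0.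
move: (Q ^ _)%N => u; nia.
Qed.

Section packing.
Context (R : realType) (sig : hz -> R) (c gam eta r tau : R).
Hypotheses (sigM : forall g h, sig (hzmul g h) <= sig g + sig h)
  (sigV : forall g, sig (hzinv g) = sig g) (sig1 : sig hz1 = 0)
  (c0 : 0 < c) (gam0 : 0 < gam)
  (sig_ge : forall g, c * (gauge g)%:R `^ gam <= sig g)
  (sig_dil : forall j g,
    `|sig (iter j dilate g) - 2 `^ (j%:R * gam) * sig g| <= eta * 2 `^ (j%:R * gam))
  (tau_eta : eta < tau) (r_tau : 2 * r + tau + eta <= 16 `^ gam * (tau - eta)).
Variable s : seq hz.
Hypotheses (s_uniq : uniq s) (s_r : forall g, g \in s -> sig g <= r)
  (s_sep : forall g h, g \in s -> h \in s -> g != h -> tau < sig (hzmul (hzinv g) h)).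

(* Products of dilates of elements of s stay distinct, and their number
   (size s)^i cannot exceed the order 16^(4 i) of the volume of the ball they lie
   in. *)
Fixpoint packing (i : nat) : seq hz :=
  if i is i'.+1 then
    [seq hzmul (iter (4 * i') dilate g) h | g <- s, h <- packing i']
  else [:: hz1].

(** Radius of the i-th product set. Two of its elements differ by at most 2 T i, which is tau - eta
    times the dilation factor: what is left of the separation after dilation. [r_tau] says that one
    more factor multiplies the radius by at most 16^gam. *)
Let T i : R := 2 `^ ((4 * i)%:R * gam) * ((tau - eta) / 2).

Let T_S i : T i.+1 = 16 `^ gam * T i.
Proof.
rewrite /T [RHS]mulrA; congr (_ * _).
have -> : 16 `^ gam = 2 `^ (4 * gam) :> R.
  by rewrite powRrM -[4]/(4%:R) powR_mulrn//; congr (_ `^ _); ring.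
by rewrite -powRD ?pnatr_eq0 ?implybT//; congr (_ `^ _); rewrite mulnS natrD; ring.
Qed.

Lemma iter_dilateM j g h :
  iter j dilate (hzmul g h) = hzmul (iter j dilate g) (iter j dilate h).
Proof. by elim: j => //= j ->; rewrite dilateM. Qed.

Lemma iter_dilateV j g : iter j dilate (hzinv g) = hzinv (iter j dilate g).
Proof. by elim: j => //= j ->; rewrite dilateV. Qed.

Lemma packing_sig i h : h \in packing i -> sig h <= T i.
Proof.
elim: i h => [|i IH] h /=.
  by rewrite inE => /eqP ->; rewrite sig1 mulr_ge0 ?powR_ge0// divr_ge0// subr_ge0 ltW.
move=> /allpairsP[[g k] /= [gs ki ->]]; apply: le_trans (sigM _ _) _.
rewrite T_S.
have h1 : sig (iter (4 * i) dilate g) <= 2 `^ ((4 * i)%:R * gam) * (r + eta).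
  have := sig_dil (4 * i) g; rewrite ler_norml => /andP[_].
  rewrite lerBlDr => /le_trans; apply.
  by rewrite mulrDr addrC [eta * _]mulrC lerD2r ler_wpM2l ?powR_ge0// s_r.
apply: le_trans (lerD h1 (IH _ ki)) _.
rewrite /T [leRHS]mulrCA -mulrDr ler_wpM2l ?powR_ge0//.
by rewrite mulrA ler_pdivlMr//; apply: le_trans r_tau; lra.
Qed.

(** If products with leading factors g1 != g2 coincided, the dilate of g1^-1 g2 would be k1 k2^-1,
    of [sig] at most 2 T i. Separation and near homogeneity force it to be strictly larger. *)
Lemma packing_uniq i : uniq (packing i).
Proof.
elim: i => [//|i IH] /=; apply: allpairs_uniq => // -[g h] [g' h'] /=.
move=> /allpairsP[[g1 k1] /= [gs ki [-> ->]]] /allpairsP[[g2 k2] /= [gs' ki' [-> ->]]].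
move=> {g h g' h'} e.
have [gg|gg] := eqVneq g1 g2.
  by move: e; rewrite gg => /(can_inj (hzmulK _)) ->.
have e2 : iter (4 * i) dilate (hzmul (hzinv g1) g2) = hzmul k1 (hzinv k2).
  rewrite iter_dilateM iter_dilateV; apply: (can_inj (hzmulK (iter (4 * i) dilate g1))).
  by rewrite hzmulVK hzmulA e -hzmulA hzmulrV hzmulr1.
have := sig_dil (4 * i) (hzmul (hzinv g1) g2); rewrite e2 ler_norml => /andP[+ _].
have := sigM k1 (hzinv k2); rewrite sigV.
have := packing_sig ki; have := packing_sig ki'; rewrite /T.
have := s_sep gs gs' gg; have : 0 < 2 `^ ((4 * i)%:R * gam) :> R by exact: powR_gt0.
move: (2 `^ _) (sig (hzmul (hzinv g1) g2)) => P sg P0 h1 h2 h3 h4 h5.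
have : P * tau < P * sg by rewrite ltr_pM2l.
by move: {e e2 gg} h2 h3 h4 h5 => *; exfalso; nra.
Qed.

Lemma size_packing i : size (packing i) = (size s ^ i)%N.
Proof. by elim: i => //= i IH; rewrite size_allpairs IH expnS. Qed.

(** By [sig_ge], the bound T i on [sig] becomes a bound K 16^i on the gauge, with K independent of
    i. So (size s)^i is at most 27 K^4 (2^16)^i, and [exp_growth] removes the constant. *)
Lemma packing_bound : (size s <= 2 ^ 16)%N.
Proof.
pose K := (Num.truncn (((tau - eta) / 2 / c) `^ gam^-1)).+1.
apply: (@exp_growth _ _ (27 * K ^ 4)) => [|i]; first by rewrite expn_gt0.
rewrite -size_packing.
have -> : (27 * K ^ 4 * (2 ^ 16) ^ i = 27 * (K * 16 ^ i) ^ 4)%N.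
  have e16 : 16%N = (2 ^ 4)%N by [].
  have -> : (2 ^ 16 = 16 ^ 4)%N by rewrite e16 -expnM.
  by rewrite expnMn -mulnA -!expnM (mulnC 4%N).
apply: leq_trans (size_hz_box_le _); last by rewrite muln_gt0 expn_gt0.
apply: uniq_leq_size; first exact: packing_uniq.
move=> h hi; rewrite mem_hz_box -(ler_nat R).
have := le_trans (sig_ge h) (packing_sig hi).
rewrite mulrC -ler_pdivlMr// => hh.
have gi : 0 < gam^-1 by rewrite invr_gt0.
have : ((gauge h)%:R `^ gam) `^ gam^-1 <= (T i / c) `^ gam^-1.
  apply: ge0_ler_powR => //; rewrite ?nnegrE ?powR_ge0 ?(ltW gi)//.
  by apply: le_trans hh; exact: powR_ge0.
rewrite -powRrM mulfV ?gt_eqF// powRr1// => /le_trans; apply.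
rewrite /T -mulrA powRM ?powR_ge0//; last by rewrite !divr_ge0 ?subr_ge0 ?(ltW c0) ?(ltW tau_eta).
rewrite -powRrM mulfK ?gt_eqF// powR_mulrn// exprM.
have -> : 2 ^+ 4 = 16%:R :> R by rewrite -natrX.
by rewrite natrM natrX [leLHS]mulrC ler_wpM2r ?exprn_ge0// ltW// truncnS_gt.
Qed.

End packing.

(** * Snowflakes of the integers *)

Section snowflake.
Context (R : realType) (p b : R).
Hypotheses (p1 : 1 <= p) (b0 : 0 < b) (bp : 1 < (1 - b) * p).

(** The exponent b will be th - 1/p: a step of n changes the value by about n^b on about n integers,
    which has l_p norm of order n^(b + 1/p) = n^th. The condition [bp] says that the derivative i^(b
    - 1) is p-summable at infinity. *)
Definition ipow (i : int) : R := if i is Posz n then n%:R `^ b else 0.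

Let p0 : 0 < p. Proof. exact: lt_le_trans p1. Qed.

Let b1 : b < 1.
Proof.
rewrite ltNge; apply/negP => b1; have : (1 - b) * p <= 0 by rewrite mulr_le0_ge0 ?(ltW p0)//; lra.
by move: bp; lra.
Qed.

Lemma ipow0 : ipow 0 = 0.
Proof. by rewrite /= powR0// gt_eqF. Qed.

Lemma ipow_ge0 i : 0 <= ipow i.
Proof. by case: i => n //=; rewrite powR_ge0. Qed.

Lemma ipow_le i j : i <= j -> ipow i <= ipow j.
Proof.
case: i => [m|m] ij; last exact: ipow_ge0.
case: j ij => [n|n] ij; last by lia.
by rewrite /= ge0_ler_powR ?nnegrE ?ler_nat ?(ltW b0).
Qed.

Lemma ipowM (m : nat) i : ipow (m%:Z * i) = m%:R `^ b * ipow i.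
Proof.
case: i => n; first by rewrite -PoszM /= natrM powRM.
rewrite /= mulr0; case: m => [|m]; first by rewrite mul0r ipow0.
by have -> : m.+1%:Z * Negz n = Negz (m.+1 * n.+1).-1 by rewrite !NegzE; lia.
Qed.

Let D i := ipow (i + 1) - ipow i.

Let D_ge0 i : 0 <= D i.
Proof. by rewrite subr_ge0 ipow_le// lerDl. Qed.

(** Since b <= 1, (1 + 1/n)^b <= 1 + 1/n. *)
Let D_le n : (0 < n)%N -> D (Posz n) <= n%:R `^ (b - 1).
Proof.
move=> n0; have n0' : 0 < n%:R :> R by rewrite ltr0n.
rewrite /D -PoszD /= powRB; last by rewrite (gt_eqF n0') implybT.
rewrite powRr1 ?ler0n//.
have -> : (n + 1)%:R = n%:R * (1 + n%:R^-1) :> R.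
  by rewrite mulrDr mulr1 mulfV ?gt_eqF// natrD.
rewrite powRM ?ler0n ?addr_ge0 ?invr_ge0//.
rewrite -[X in _ - X]mulr1 -mulrBr ler_wpM2l ?powR_ge0//.
rewrite lerBlDl; apply: le_trans (ler1_powR _ (ltW b1)) _ => //.
by rewrite lerDl invr_ge0.
Qed.

Lemma lp_ipow1 : lp p (fun i => ipow (i + 1) - ipow i).
Proof.
have pn0 : p != 0 by rewrite gt_eqF.
rewrite /lp (@psum_inj _ _ _ _ Posz)//; last 2 first.
- by move=> m n [].
- move=> [n|[|n]] h; first by case: h; exists n.
    by rewrite -[Negz 0 + 1]/(0 : int) ipow0 /= subr0.
  have -> : Negz n.+1 + 1 = Negz n by rewrite !NegzE; lia.
  by rewrite subrr.
pose s := (1 - b) * p; pose x : R := 2 `^ (1 - s).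
have x0 : 0 < x by exact: powR_gt0.
have s1 : 1 < s by [].
have x1 : x < 1 by rewrite /x -opprB powR2N_lt1// subr_gt0.
apply: (@le_lt_trans _ _ (1 + (1 + (1 - x)^-1))%:E); last exact: ltry.
apply: psum_nat_le => N.
(* Cauchy condensation: each of the 2^K terms from 2^K to 2^(K+1) is at most 2^(-K s), so the block
   contributes at most x^K. *)
have dyadic K : \sum_(1 <= n < 2 ^ K) `|D n| `^ p <= \sum_(k < K) x ^+ k.
  elim: K => [|K IH]; first by rewrite big_geq// big_ord0.
  rewrite big_ord_recr /= (@big_cat_nat _ _ _ (2 ^ K)%N) /=; last 2 first.
  - by rewrite expn_gt0.
  - by rewrite leq_exp2l.
  apply: lerD => //.
  apply: (@le_trans _ _ (\sum_(2 ^ K <= n < 2 ^ K.+1) (2 ^+ K) `^ (- s))).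
    apply: ler_sum_nat => n /andP[Kn _].
    have n0 : (0 < n)%N by apply: leq_trans Kn; rewrite expn_gt0.
    rewrite ger0_norm//.
    apply: (@le_trans _ _ ((n%:R `^ (b - 1)) `^ p)).
      by rewrite ge0_ler_powR ?nnegrE ?powR_ge0 ?D_le// (ltW p0).
    rewrite -powRrM.
    have -> : (b - 1) * p = - s by rewrite /s; ring.
    rewrite !powRN lef_pV2 ?posrE ?powR_gt0 ?exprn_gt0 ?ltr0n//.
    rewrite ge0_ler_powR ?nnegrE ?exprn_ge0//; first by apply: ltW; apply: lt_trans s1.
    by rewrite -natrX ler_nat.
  rewrite sumr_const_nat.
  rewrite expnS mul2n -addnn addnK.
  rewrite -[_ *+ (2 ^ K)%N]mulr_natl natrX.
  have -> : 2 ^+ K = 2 `^ K%:R :> R by rewrite powR_mulrn.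
  rewrite -powRrM -powRD; last by rewrite pnatr_eq0 implybT.
  by rewrite -powR_mulrn ?powR_ge0// -powRrM le_eqVlt; apply/predU1P; left; congr (_ `^ _); ring.
rewrite -(big_mkord xpredT (fun n => `|D (Posz n)| `^ p)).
apply: (@le_trans _ _ (\sum_(0 <= n < 2 ^ N) `|D (Posz n)| `^ p)).
  rewrite [leRHS](@big_cat_nat _ _ _ N) //=; last by rewrite ltnW// ltn_expl.
  by rewrite lerDl sumr_ge0// => n _; exact: powR_ge0.
rewrite big_ltn ?expn_gt0//; apply: lerD.
  by rewrite /D add0r ipow0 subr0 /= powR1 normr1 powR1.
apply: le_trans (dyadic N) _.
have := @geometric_le_lim R N 1 x ler01 x0.
rewrite gtr0_norm// => /(_ x1); rewrite mul1r /series /= big_mkord.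
rewrite (eq_bigr (fun i : 'I_N => x ^+ i)) => [|i _]; last by rewrite mul1r.
by move=> /le_trans; apply; rewrite lerDr.
Qed.

Definition ipow_diff (n : nat) (i : int) : R := ipow (i + n%:Z) - ipow i.

Lemma addr_bij (n : int) : bijective (fun i : int => i + n).
Proof. by exists (fun i => i - n) => i; [rewrite addrK|rewrite subrK]. Qed.

Lemma lp_ipow_diff n : lp p (ipow_diff n).
Proof.
elim: n => [|n IH].
  have -> : ipow_diff 0 = fun=> 0 by apply/funext => i; rewrite /ipow_diff addr0 subrr.
  by rewrite /lp psum.unlock esum1// => i _; rewrite normr0 powR0// gt_eqF.
have -> : ipow_diff n.+1 = fun i => ipow_diff n (i + 1) + ipow_diff 1 i.
  apply/funext => i; by rewrite /ipow_diff intS !addrA subrK.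
by apply: lpD => //; [exact: (lp_reindex (addr_bij 1) IH)|exact: lp_ipow1].
Qed.

Definition ediv (m : nat) (i : int) : int * 'I_m.+1 :=
  ((i %/ m.+1%:Z)%Z, inord `|(i %% m.+1%:Z)%Z|%N).

Definition emul (m : nat) (t : int * 'I_m.+1) : int := m.+1%:Z * t.1 + (t.2 : nat)%:Z.

Lemma emulK m : cancel (@emul m) (@ediv m).
Proof.
move=> [i c]; rewrite /emul /ediv /=; have mm : m.+1%:Z != 0 by [].
rewrite mulrC divzMDl// modzMDl.
rewrite divz_small ?modz_small ?addr0; last 2 first.
- by rewrite /= ltz_nat ltn_ord.
- by rewrite /= ltz_nat ltn_ord.
by rewrite absz_nat inord_val.
Qed.

Lemma edivK m : cancel (@ediv m) (@emul m).
Proof.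
move=> i; rewrite /emul /ediv /= inordK.
  by rewrite gez0_abs ?modz_ge0// mulrC -divz_eq.
by rewrite -ltz_nat gez0_abs ?modz_ge0// ltz_pmod.
Qed.

Lemma emul_bij m : bijective (@emul m).
Proof. by exists (@ediv m); [exact: emulK|exact: edivK]. Qed.

(* Writing an integer as m i + c, the difference operator of step m n is
   m^b times that of step n, up to an error that does not depend on n. *)
Lemma pnorm_ipow_diffM (m n : nat) : (0 < m)%N ->
  `|pnorm p (ipow_diff (m * n)) - m%:R `^ (b + p^-1) * pnorm p (ipow_diff n)|
    <= 2 * m%:R `^ (b + p^-1) * pnorm p (ipow_diff 1).
Proof.
case: m => // m _; set mb := m.+1%:R `^ b.
have mbp : m.+1%:R `^ (b + p^-1) = m.+1%:R `^ p^-1 * mb.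
  by rewrite addrC powRD// pnatr_eq0 implybT.
have mb0 : 0 <= mb by exact: powR_ge0.
pose X (t : int * 'I_m.+1) := ipow_diff (m.+1 * n) (emul t).
pose Y (t : int * 'I_m.+1) := mb * ipow_diff n t.1.
pose W (t : int * 'I_m.+1) := mb * ipow_diff 1 t.1.
pose W' (t : int * 'I_m.+1) := mb * ipow_diff 1 (t.1 + n%:Z).
have lpC k : lp p (fun t : int * 'I_m.+1 => mb * ipow_diff k t.1).
  by apply: lpZ; apply: lp_fst; exact: lp_ipow_diff.
have pnC k : pnorm p (fun t : int * 'I_m.+1 => mb * ipow_diff k t.1) =
    m.+1%:R `^ (b + p^-1) * pnorm p (ipow_diff k).
  by rewrite pnormZ// (pnorm_fst _ p0 (lp_ipow_diff k)) card_ord ger0_norm// mbp mulrA (mulrC mb).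
have lpS : lp p (fun i => ipow_diff 1 (i + n%:Z)).
  exact: (lp_reindex (addr_bij n%:Z) (lp_ipow_diff 1)).
have lpW' : lp p W'.
  apply: lpZ; apply: (lp_fst _ lpS).
have pnW' : pnorm p W' = m.+1%:R `^ (b + p^-1) * pnorm p (ipow_diff 1).
  rewrite /W' pnormZ// (pnorm_fst _ p0 lpS).
  rewrite -(pnorm_reindex _ _ (addr_bij n%:Z)) card_ord ger0_norm//.
  by rewrite mbp mulrA (mulrC mb).
have lpX : lp p X by apply: (lp_reindex (emul_bij m)); exact: lp_ipow_diff.
rewrite (pnorm_reindex p (ipow_diff (m.+1 * n)) (emul_bij m)) -[_ \o _]/X.
rewrite -(pnC n) -[fun t => _]/Y.
apply: le_trans (pnorm_dist p1 lpX (lpC n)) _.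
(* Homogeneity turns m^b [ipow i] into the value at m i; both bounds are then monotonicity between m
   i, m i + c and m (i + 1). *)
have Z i (c : 'I_m.+1) : 0 <= ipow (emul (i, c)) - mb * ipow i <= mb * ipow_diff 1 i.
  have mbE j : mb * ipow j = ipow (m.+1%:Z * j) by rewrite ipowM.
  rewrite /ipow_diff mulrBr !mbE; apply/andP; split.
    by rewrite subr_ge0 ipow_le// /emul /= lerDl.
  by rewrite lerD2r ipow_le// /emul /= mulrDr mulr1 lerD2l lez_nat ltnW.
apply: (@le_trans _ _ (pnorm p (fun t => W' t + W t))).
  apply: le_pnorm => //; last by apply: lpD => //; exact: (lpC 1%N).
  move=> [i c]; rewrite /X /Y /W /W' /= {1}/ipow_diff.
  have -> : emul (i, c) + (m.+1 * n)%N%:Z = emul (i + n%:Z, c).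
    by rewrite /emul /= PoszM; ring.
  have /andP[h1 h2] := Z i c; have /andP[h3 h4] := Z (i + n%:Z) c.
  have -> : ipow_diff n i = ipow (i + n%:Z) - ipow i by [].
  rewrite [leRHS]ger0_norm; last by rewrite addr_ge0 ?(le_trans h1 h2)// (le_trans h3 h4).
  have aux (a a' w w' : R) : 0 <= a -> a <= w -> 0 <= a' -> a' <= w' -> `|a' - a| <= w' + w.
    by move=> *; rewrite ler_norml; apply/andP; split; lra.
  apply: le_trans (aux _ _ _ _ h1 h2 h3 h4); rewrite le_eqVlt; apply/predU1P; left.
  by congr (`|_|); ring.
apply: le_trans (pnormD p1 lpW' (lpC 1%N)) _.
by rewrite pnW' pnC -mulrA; lra.
Qed.

End snowflake.

(** Only differences are required to be in l_p: translates of [ipow] are themselves unbounded. *)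
Definition snowflake (R : realType) (p th del : R) (T : choiceType) (psi : int -> T -> R) :=
  forall a b : int, lp p (fun i => psi a i - psi b i) /\
   `|a - b|%N%:R `^ th <= pnorm p (fun i => psi a i - psi b i)
     <= (1 + del) * `|a - b|%N%:R `^ th.

Lemma psum0 (R : realType) (T : choiceType) (p : R) : p != 0 -> psum p (fun _ : T => 0 : R) = 0%E.
Proof. by move=> p0; rewrite psum.unlock esum1// => i _; rewrite normr0 powR0. Qed.

Lemma snowflake_sym (R : realType) (p th del : R) (T : choiceType) (psi : int -> T -> R) :
  (forall (a : int) (n : nat), lp p (fun i => psi (a + n%:Z) i - psi a i) /\
   n%:R `^ th <= pnorm p (fun i => psi (a + n%:Z) i - psi a i) <= (1 + del) * n%:R `^ th) ->
  snowflake p th del psi.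
Proof.
move=> h a b.
wlog ba : a b / b <= a.
  move=> w; case/orP: (le_total b a); first exact: w.
  move=> ab; have [wl wp] := w b a ab; rewrite distnC.
  rewrite /lp (@psum_eq _ _ _ _ (fun i => psi b i - psi a i)); last by move=> t; exact: distrC.
  by rewrite (@pnorm_eq _ _ _ _ (fun i => psi b i - psi a i)) => // t; exact: distrC.
have := h b `|a - b|%N.
by have -> : b + `|a - b|%N%:Z = a by lia.
Qed.

Lemma snowflake_id (R : realType) (p : R) : 0 < p ->
  snowflake p 1 0 (fun (a : int) (t : unit) => a%:~R : R).
Proof.
move=> p0; apply: snowflake_sym => a n.
have e : (fun _ : unit => (a + n%:Z)%:~R - a%:~R : R) = (fun t : unit => n%:R * 1).
  by apply/funext => t; rewrite intrD addrC addKr mulr1.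
have p1 : psum p (fun _ : unit => 1 : R) = 1%E.
  rewrite psum.unlock (_ : [set: unit] = [set tt]); last by apply/seteqP; split => -[].
  by rewrite esum_set1 normr1 powR1.
rewrite e; have l1 : lp p (fun _ : unit => 1 : R) by rewrite /lp p1 ltry.
split; first exact: lpZ.
by rewrite pnormZ// pnorm.unlock p1 /= powR1 mulr1 addr0 mul1r powRr1// ger0_norm// lexx.
Qed.

(** By [pnorm_ipow_diffM], g (n M) lies within 2 n^th g 1 of n^th g M. As g M >= M^b is unbounded, M
    can be chosen with 2 g 1 negligible against g M. Translating by multiples of M and dividing by A
    = g M - 2 g 1 gives the embedding. *)
Lemma snowflake_exists (R : realType) (p th del : R) : 1 <= p -> p^-1 < th < 1 -> 0 < del ->
  exists psi : int -> int -> R, snowflake p th del psi.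
Proof.
move=> p1 /andP[thp th1] del0.
have p0 : 0 < p by exact: lt_le_trans p1.
have th0 : 0 < th by apply: lt_trans thp; rewrite invr_gt0.
pose b := th - p^-1.
have b0 : 0 < b by rewrite subr_gt0.
have bp : 1 < (1 - b) * p.
  rewrite /b opprB addrA mulrBl mulrDl mul1r mulVf ?gt_eqF//.
  have : th * p < 1 * p by rewrite ltr_pM2r.
  lra.
have bth : b + p^-1 = th by rewrite subrK.
pose g n := pnorm p (ipow_diff b n).
pose K := 2 * g 1%N.
have K0 : 0 <= K by rewrite mulr_ge0 ?pnorm_ge0.
pose B := K * (2 + del) / del + 1.
have B0 : 0 <= B.
  by apply: addr_ge0 => //; apply: divr_ge0; [apply: mulr_ge0 => //; lra|exact: ltW].
pose M := (Num.truncn (B `^ b^-1)).+1.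
have gM : B <= g M.
  apply: (@le_trans _ _ (M%:R `^ b)).
    have -> : B = (B `^ b^-1) `^ b by rewrite -powRrM mulVf ?gt_eqF// powRr1.
    apply: ge0_ler_powR; rewrite ?nnegrE ?powR_ge0 ?(ltW b0)//.
    by apply: ltW; exact: truncnS_gt.
  have := @normr_le_pnorm _ _ p (ipow_diff b M) 0 p0 (lp_ipow_diff p1 b0 bp M).
  by rewrite {1}/ipow_diff add0r ipow0// subr0 /= ger0_norm ?powR_ge0.
have KdB : K * (2 + del) / del < B by rewrite ltrDl.
have K2 : K * (2 + del) <= del * g M.
  by rewrite [leRHS]mulrC -ler_pdivrMr//; apply: le_trans gM; exact: ltW.
pose A := g M - K.
have A0 : 0 < A.
  rewrite subr_gt0; apply: lt_le_trans gM; apply: le_lt_trans KdB.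
  by rewrite ler_pdivlMr//; nra.
have gMA : g M + K <= (1 + del) * A by rewrite /A; nra.
exists (fun a i => A^-1 * ipow b (i + M%:Z * a)); apply: snowflake_sym => a n.
have e : (fun i => A^-1 * ipow b (i + M%:Z * (a + n%:Z)) - A^-1 * ipow b (i + M%:Z * a))
    = (fun i => A^-1 * (ipow_diff b (n * M) \o (fun i => i + M%:Z * a)) i).
  apply/funext => i; rewrite -mulrBr /ipow_diff /=; congr (_ * (ipow _ _ - _)).
  by rewrite PoszM; ring.
rewrite e; split.
  by apply: lpZ; apply: lp_reindex (addr_bij _) _; exact: lp_ipow_diff.
rewrite pnormZ// -pnorm_reindex; last exact: addr_bij.
rewrite gtr0_norm ?invr_gt0// mulrC ler_pdivlMr// ler_pdivrMr//.
case: n {e} => [|n].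
  have -> : ipow_diff b (0 * M) = (fun=> 0).
    by apply/funext => i; rewrite /ipow_diff mul0n addr0 subrr.
  rewrite powR0 ?gt_eqF// pnorm.unlock psum0 ?gt_eqF//= powR0 ?invr_eq0 ?gt_eqF//.
  by rewrite mulr0 mul0r lexx.
have := pnorm_ipow_diffM p1 b0 bp M (isT : 0 < n.+1)%N; rewrite bth -/(g M) -/(g 1%N).
have P0 : 0 <= n.+1%:R `^ th :> R by exact: powR_ge0.
rewrite /A /K in gMA *; move: (n.+1%:R `^ th) P0 (pnorm _ _) => P P0 Q.
rewrite ler_norml => /andP[h1 h2]; apply/andP; split; first by nra.
have : (1 + del) * P * (g M - 2 * g 1%N) = P * ((1 + del) * (g M - 2 * g 1%N)) by ring.
by move=> ->; apply: (@le_trans _ _ (P * (g M + 2 * g 1%N))); [lra|exact: ler_wpM2l].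
Qed.

(** * The cocycle *)

Lemma gauge_iter_dilate_le n g : (gauge (iter n dilate g) <= 2 ^ n * gauge g)%N.
Proof.
elim: n => [|n IH] /=; first by rewrite expn0 mul1n.
by apply: leq_trans (gauge_dilate_le _) _; rewrite expnS -mulnA leq_mul2l.
Qed.

(** Iterating [gauge_dilate_ge] would lose 2^n - 1, leaving almost nothing at gauge 1; the
    coordinates of the n-th dilate are compared directly instead. *)
Lemma gauge_iter_dilate_ge n g : (2 ^ n * gauge g <= 2 * gauge (iter n dilate g))%N.
Proof.
have iterE : iter n dilate g = (2 ^+ n * g.1.1, 2 ^+ n * g.1.2, 4 ^+ n * g.2).
  elim: n => [|n /= ->]; first by rewrite !expr0 !mul1r; case: g => [[]].
  by rewrite /dilate /= !exprS !mulrA.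
have := gauge_fits (iter n dilate g); set G := gauge _; rewrite iterE /hz_fits /=.
rewrite !abszM !abszX => /and3P[]; rewrite -[`|2|%N]/2%N -[`|4|%N]/4%N.
have p2 : (0 < 2 ^ n)%N by rewrite expn_gt0.
have -> : (4 ^ n = 2 ^ n * 2 ^ n)%N by rewrite -expnMn.
move=> xG yG zG.
rewrite mulnC -leq_divRL// gauge_le; apply/and3P; split.
- by rewrite leq_divRL// mulnC; lia.
- by rewrite leq_divRL// mulnC; lia.
have [->//|z0] := posnP `|g.2|%N.
(* A nonzero central coordinate forces G >= 2^n, so rounding 2 G / 2^n down still leaves at least G
   / 2^n. *)
have pG : (2 ^ n <= G)%N by rewrite -leq_sqr; apply: leq_trans zG; rewrite -mulnn leq_pmulr.
have := divn_eq (2 * G) (2 ^ n); have := ltn_pmod (2 * G) p2.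
move: (2 * G %/ 2 ^ n)%N (2 * G %% 2 ^ n)%N => f u up fE.
have Gf : (G <= f * 2 ^ n)%N by lia.
have : (`|g.2| * (2 ^ n) ^ 2 <= f ^ 2 * (2 ^ n) ^ 2)%N.
  by rewrite -expnMn mulnC -mulnn; apply: leq_trans zG _; rewrite leq_sqr.
by rewrite leq_pmul2r// expn_gt0 p2.
Qed.

Definition bump (k : nat) (h : hz) : nat := (2 ^ k - gauge h)%N.

Lemma bump_le k h : (bump k h <= 2 ^ k)%N.
Proof. exact: leq_subr. Qed.

Lemma bump_gt0 k h : (0 < bump k h)%N = (gauge h < 2 ^ k)%N.
Proof. by rewrite subn_gt0. Qed.

Lemma gauge_translate g h : (gauge h <= gauge (hzmul (hzinv g) h) + gauge g)%N.
Proof. by rewrite -[X in (gauge X <= _)%N](hzmulVK g) addnC gaugeM. Qed.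

(** The factor 2 comes from [gaugeV]. *)
Lemma bump_translate k g h :
  (`|(bump k (hzmul (hzinv g) h))%:Z - (bump k h)%:Z| <= 2 * gauge g)%N.
Proof.
have h1 := gauge_translate g h; have h2 := gaugeM (hzinv g) h; have := gaugeV g.
rewrite /bump; lia.
Qed.

(** If h and g^-1 h both had gauge below 2^k, then g = h (g^-1 h)^-1 would have gauge below 2^k + 2
    2^k, the second term being doubled by inversion. *)
Lemma bump_disjoint k g h : (3 * 2 ^ k <= gauge g)%N ->
  (0 < bump k h)%N -> bump k (hzmul (hzinv g) h) = 0%N.
Proof.
move=> gk; rewrite bump_gt0 => hk; apply/eqP; rewrite subn_eq0 leqNgt; apply/negP => ghk.
have := gaugeM h (hzinv (hzmul (hzinv g) h)); have := gaugeV (hzmul (hzinv g) h).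
rewrite {2}hzinvM hzinvK hzmulA hzmulrV hzmul1; lia.
Qed.

Lemma natr_dist (R : realDomainType) (m n : nat) :
  `|m%:R - n%:R| = `|m%:Z - n%:Z|%N%:R :> R.
Proof. by rewrite natr_absz intr_norm intrB. Qed.

(** * Upper and lower bounds for the cocycle norm *)

Section cocycle.
Context (R : realType) (q e : R).
Hypotheses (q1 : 1 <= q) (e0 : 0 < e) (e1 : e < 1) (eq1 : 1 <= (1 - e) * q).

Let q0 : 0 < q. Proof. exact: lt_le_trans q1. Qed.

(** The part 4/q of the exponent cancels the volume 16^k of a ball of scale k: in q-th power sums,
    weight and volume together leave 2^(-e q k). *)
Definition weight_base : R := 2 `^ (- (e + 4 / q)).
Let v := weight_base.

Definition bump_coc (g : hz) (t : nat * hz) : R :=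
  v ^+ t.1 * ((bump t.1 (hzmul (hzinv g) t.2))%:R - (bump t.1 t.2)%:R).

Definition coc_norm (g : hz) : R := pnorm q (bump_coc g).

Let v0 : 0 < v. Proof. exact: powR_gt0. Qed.

Let s := 2 `^ (- (e * q)) : R.
Let r := 2 `^ ((1 - e) * q) : R.

Let s01 : 0 < s < 1.
Proof. by rewrite powR_gt0//= powR2N_lt1// mulr_gt0. Qed.

(** Here [eq1] ensures that the contributions of small scales at least double from one scale to the
    next, so that their sum has a constant independent of q and e. *)
Let r2 : 2 <= r.
Proof. by rewrite /r -[leLHS]powRr1// ler_powR// ler1n. Qed.

Let vq : v `^ q * 16 = s.
Proof.
have -> : (16 : R) = 2 `^ 4 by rewrite -[4 : R]/(4%:R) powR_mulrn// -natrX.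
rewrite /v /weight_base -powRrM -powRD; last by rewrite pnatr_eq0 implybT.
by congr (_ `^ _); field; rewrite gt_eqF.
Qed.

Let sr : s * 2 `^ q = r.
Proof.
rewrite /s /r -powRD; last by rewrite pnatr_eq0 implybT.
by congr (_ `^ _); ring.
Qed.

Lemma weight_powR (k : nat) (m : R) (n : nat) : 0 <= m ->
  (n * 16 ^ k)%:R * (v ^+ k * m) `^ q = n%:R * s ^+ k * m `^ q.
Proof.
move=> m0; rewrite powRM ?exprn_ge0 ?(ltW v0)// -vq exprMn natrM natrX.
have -> : (v ^+ k) `^ q = (v `^ q) ^+ k.
  rewrite -(powR_mulrn _ (ltW v0)) -(powR_mulrn _ (powR_ge0 v q)) -!powRrM.
  by rewrite (mulrC q).
by ring.
Qed.

Lemma bump_cocM g g' k h :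
  bump_coc (hzmul g g') (k, h) = bump_coc g' (k, hzmul (hzinv g) h) + bump_coc g (k, h).
Proof. by rewrite /bump_coc /= hzinvM -hzmulA; ring. Qed.

Lemma bump_cocV g k h : bump_coc (hzinv g) (k, h) = - bump_coc g (k, hzmul g h).
Proof. by rewrite /bump_coc /= hzinvK hzmulK; ring. Qed.

Lemma translate_bij g : bijective (fun t : nat * hz => (t.1, hzmul g t.2)).
Proof.
exists (fun t => (t.1, hzmul (hzinv g) t.2)) => -[k h] /=.
  by rewrite hzmulK.
by rewrite hzmulVK.
Qed.

Lemma bump_coc_le_gauge g k h : `|bump_coc g (k, h)| <= v ^+ k * (2 * gauge g)%:R.
Proof.
rewrite /bump_coc /= normrM ger0_norm ?exprn_ge0 ?(ltW v0)// ler_wpM2l ?exprn_ge0 ?(ltW v0)//.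
by rewrite natr_dist ler_nat bump_translate.
Qed.

Lemma bump_coc_le_scale g k h : `|bump_coc g (k, h)| <= v ^+ k * (2 ^ k)%:R.
Proof.
rewrite /bump_coc /= normrM ger0_norm ?exprn_ge0 ?(ltW v0)// ler_wpM2l ?exprn_ge0 ?(ltW v0)//.
rewrite natr_dist ler_nat.
have := bump_le k h; have := bump_le k (hzmul (hzinv g) h); lia.
Qed.

(** The support lies in the ball of radius 2^k and its translate by g, each of at most 27 16^k
    points; hence 54. *)
Lemma psum_bump_coc_scale g k : (psum q (fun h => bump_coc g (k, h)) <=
   ((54 * s ^+ k * Num.min (2 ^ k)%:R (2 * gauge g)%:R `^ q)%:E))%E.
Proof.
set B := Num.min _ _; have B0 : 0 <= B by rewrite /B le_min !ler0n.
pose L := hz_box (2 ^ k) ++ [seq hzmul g h | h <- hz_box (2 ^ k)].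
apply: (@le_trans _ _ ((size L)%:R * (v ^+ k * B) `^ q)%:E).
  apply: psum_supp => // h.
    rewrite /bump_coc mulf_eq0 negb_or => /andP[_] /= hh.
    rewrite mem_cat mem_hz_box.
    have [//|hk] := leqP (gauge h) (2 ^ k); rewrite orFb.
    apply/mapP; exists (hzmul (hzinv g) h); last by rewrite hzmulVK.
    rewrite mem_hz_box leqNgt; apply: contra hh => ghk.
    by rewrite /bump (eqP (ltnW hk)) (eqP (ltnW ghk)) subrr.
  by rewrite /B minEle; case: ifP => _; [exact: bump_coc_le_scale|exact: bump_coc_le_gauge].
rewrite lee_fin; apply: le_trans (_ : (54 * 16 ^ k)%:R * (v ^+ k * B) `^ q <= _).
  rewrite ler_wpM2r ?powR_ge0// ler_nat size_cat size_map addnn -mul2n.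
  have := @size_hz_box_le (2 ^ k); rewrite expn_gt0 => /(_ isT).
  by rewrite -expnM (mulnC k) expnM -[(2 ^ 4)%N]/16%N; lia.
by rewrite weight_powR.
Qed.

Let geom_tail_le : (1 - s)^-1 <= 2 / e.
Proof.
have /andP[s0 s1] := s01.
have h : s <= 1 - e / 2.
  apply: le_trans (half_powR_le (_ : 0 < e < 1)); last by rewrite e0.
  by rewrite /s ler_powR ?ler1n// lerN2 ler_peMr// ltW.
by rewrite -[leRHS]invf_div lef_pV2 ?posrE ?subr_gt0 ?divr_gt0//; lra.
Qed.

(* The scales below 2 * gauge g contribute a growing geometric series and the
   scales above it a decreasing one, of sum at most 2 / e. *)
Lemma psum_bump_coc_le g : (psum q (bump_coc g) <=
  (162 * 2 `^ q / e * (gauge g)%:R `^ ((1 - e) * q))%:E)%E.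
Proof.
have /andP[s0 s1] := s01.
have eq0 : 0 < e * q by rewrite mulr_gt0.
have [g0|g0] := posnP (gauge g).
  have -> : bump_coc g = fun=> 0.
    apply/funext => -[k h]; apply/eqP; rewrite -normr_le0.
    by have := bump_coc_le_gauge g k h; rewrite g0 muln0 mulr0.
  rewrite psum0 ?(gt_eqF q0)// lee_fin; apply: mulr_ge0; last exact: powR_ge0.
  by apply: divr_ge0; [apply: mulr_ge0 => //; exact: powR_ge0|exact: ltW].
have g0R : 0 < (gauge g)%:R :> R by rewrite ltr0n.
pose D : R := (2 * gauge g)%:R.
have D0 : 0 < D by rewrite ltr0n muln_gt0.
(* Up to rounding, the scale at which the two bounds in the minimum cross. *)
pose m := trunc_log 2 (2 * gauge g).
have mD : (2 ^ m)%:R <= D by rewrite ler_nat trunc_logP// muln_gt0.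
have Dm : D / 2 <= (2 ^ m)%:R.
  have := trunc_log_ltn (2 * gauge g) (isT : 1 < 2)%N; rewrite -/m expnS => h.
  by rewrite ler_pdivrMr// mulrC -natrM ler_nat ltnW.
pose c k := 54 * s ^+ k * Num.min (2 ^ k)%:R D `^ q.
have c0 k : 0 <= c k by rewrite mulr_ge0 ?powR_ge0// mulr_ge0// exprn_ge0// ltW.
apply: (psum_natpair_le (psum_bump_coc_scale g)) => N.
apply: (@le_trans _ _ (\sum_(k < m + N) c k)).
  rewrite -!(big_mkord xpredT c) [leRHS](@big_cat_nat _ _ _ N) ?leq_addl//=.
  by rewrite lerDl sumr_ge0.
rewrite big_split_ord /=.
have h1 : \sum_(k < m) c k <= 54 * r ^+ m.
  apply: (@le_trans _ _ (\sum_(k < m) 54 * r ^+ k)); last first.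
    by rewrite -mulr_sumr ler_wpM2l// sum_geom_ge2.
  apply: ler_sum => k _; rewrite /c -mulrA ler_wpM2l// -sr exprMn ler_wpM2l ?exprn_ge0 ?(ltW s0)//.
  rewrite -(powR_mulrn _ (powR_ge0 2 q)) -powRrM mulrC powRrM powR_mulrn// natrX.
  by rewrite ge0_ler_powR ?nnegrE ?(ltW q0) ?le_min ?exprn_ge0 ?(ltW D0)// ge_min lexx.
have h2 : \sum_(k < N) c (m + k)%N <= 54 * (D `^ q * s ^+ m) * (2 / e).
  apply: (@le_trans _ _ (\sum_(k < N) 54 * (D `^ q * s ^+ m) * s ^+ k)); last first.
    rewrite -mulr_sumr ler_wpM2l ?mulr_ge0 ?powR_ge0 ?exprn_ge0 ?(ltW s0)//.
    exact: le_trans (sum_geom_lt1 _ s01) geom_tail_le.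
  apply: ler_sum => k _; rewrite /c exprD -!mulrA ler_wpM2l//.
  rewrite [leLHS]mulrA [leLHS]mulrC ler_wpM2r ?mulr_ge0 ?exprn_ge0 ?(ltW s0)//.
  by rewrite ge0_ler_powR ?nnegrE ?(ltW q0) ?le_min ?ler0n ?(ltW D0)// ge_min lexx orbT.
apply: le_trans (lerD h1 h2) _.
have rm : r ^+ m <= D `^ ((1 - e) * q).
  rewrite /r -(powR_mulrn _ (powR_ge0 _ _)) -powRrM mulrC powRrM powR_mulrn// -natrX.
  by rewrite ge0_ler_powR ?nnegrE ?ler0n ?(ltW D0)// (le_trans _ eq1).
have sm : D `^ q * s ^+ m <= D `^ ((1 - e) * q) * 2 `^ (e * q).
  have DE : D `^ q = D `^ ((1 - e) * q) * D `^ (e * q).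
    by rewrite -powRD ?(gt_eqF D0) ?implybT//; congr (_ `^ _); ring.
  have s2 : s ^+ m * (2 ^ m)%:R `^ (e * q) = 1.
    have -> : (2 ^ m)%:R `^ (e * q) = (2 `^ (e * q)) ^+ m :> R.
      rewrite natrX -(powR_mulrn m (powR_ge0 2 (e * q))) -(powR_mulrn m (ler0n R 2)).
      by rewrite -!powRrM mulrC.
    by rewrite -exprMn /s powRN mulVf ?expr1n// gt_eqF// powR_gt0.
  rewrite DE -mulrA ler_wpM2l ?powR_ge0//.
  apply: (@le_trans _ _ ((2 * (2 ^ m)%:R) `^ (e * q) * s ^+ m)); last first.
    by rewrite powRM ?ler0n// -mulrA [X in _ * X]mulrC s2 mulr1.
  rewrite ler_wpM2r ?exprn_ge0 ?(ltW s0)// ge0_ler_powR ?nnegrE ?(ltW eq0) ?(ltW D0)//.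
  by rewrite mulrC -ler_pdivrMr.
have De : D `^ ((1 - e) * q) * 2 `^ (e * q) = 2 `^ q * (gauge g)%:R `^ ((1 - e) * q).
  rewrite /D natrM powRM ?ler0n// mulrAC -powRD; last by rewrite pnatr_eq0 implybT.
  by congr (_ `^ _ * _); ring.
set P := D `^ _ in rm sm De; set Q := 2 `^ (e * q) in sm De.
have P0 : 0 <= P by exact: powR_ge0.
have Q1 : 1 <= Q by rewrite -[leLHS](powRr0 2) ler_powR ?ler1n// ltW.
(* The small scales contribute 54, enlarged by 1 / e > 1, and the large ones 54 times 2 / e. *)
have -> : 162 * 2 `^ q / e * (gauge g)%:R `^ ((1 - e) * q) = 162 * (P * Q / e).
  by rewrite De; ring.
have PQ : P * Q <= P * Q / e.
  by rewrite ler_peMr ?mulr_ge0 ?(le_trans _ Q1)// invf_ge1// ltW.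
have : r ^+ m <= P * Q / e by apply: le_trans PQ; apply: le_trans rm _; rewrite ler_peMr.
have : D `^ q * s ^+ m * (2 / e) <= 2 * (P * Q / e).
  by rewrite mulrCA ler_wpM2l// ler_wpM2r ?invr_ge0 ?(ltW e0).
lra.
Qed.

Lemma lp_bump_coc g : lp q (bump_coc g).
Proof. by apply: le_lt_trans (psum_bump_coc_le g) _; exact: ltry. Qed.

(** A single scale is enough. If 6 2^j <= gauge g < 12 2^j, then at scale j + 1 every h of gauge at
    most 2^j has bump at least 2^j, while g^-1 h has bump 0. The constant 384 is 12 times 32, from v
    >= 2^-5. *)
Lemma coc_norm_ge g : (6 <= gauge g)%N -> (gauge g)%:R `^ (1 - e) / 384 <= coc_norm g.
Proof.
move=> g6; pose j := trunc_log 2 (gauge g %/ 6).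
have j1 : (6 * 2 ^ j <= gauge g)%N.
  by rewrite mulnC -leq_divRL// trunc_logP// divn_gt0.
have j2 : (gauge g < 12 * 2 ^ j)%N.
  have := trunc_log_ltn (gauge g %/ 6) (isT : 1 < 2)%N; rewrite -/j expnS.
  by rewrite ltn_divLR//; lia.
have h : ((v `^ q * r ^+ j)%:E <= psum q (bump_coc g))%E.
  pose L := [seq (j.+1, h) | h <- hz_box (2 ^ j)].
  apply: le_trans (@psum_ge _ _ q (v ^+ j.+1 * (2 ^ j)%:R) L _ q0 _ _ _); last 3 first.
  - by rewrite mulr_ge0 ?exprn_ge0 ?(ltW v0).
  - by rewrite map_inj_uniq ?hz_box_uniq// => ? ? [].
  - move=> _ /mapP[h + ->]; rewrite mem_hz_box => hj.
    have bh : (2 ^ j <= bump j.+1 h)%N by rewrite /bump expnS; lia.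
    rewrite /bump_coc /= (@bump_disjoint j.+1 g h); last 2 first.
    + by rewrite expnS; lia.
    + by apply: leq_trans bh; rewrite expn_gt0.
    rewrite sub0r normrM normrN !ger0_norm ?exprn_ge0 ?(ltW v0)//.
    by rewrite ler_wpM2l ?exprn_ge0 ?(ltW v0)// ler_nat.
  rewrite lee_fin; apply: le_trans (_ : (1 * 16 ^ j)%:R * (v ^+ j * (v * (2 ^ j)%:R)) `^ q <= _).
    rewrite weight_powR ?mulr_ge0 ?(ltW v0)// mul1r powRM ?ler0n ?(ltW v0)//.
    rewrite -sr exprMn natrX -[X in _ <= _ * (_ * X)](_ : (2 `^ q) ^+ j = _).
      by rewrite mulrCA lexx.
    by rewrite -(powR_mulrn _ (powR_ge0 2 q)) -powRrM mulrC powRrM powR_mulrn.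
  rewrite mul1n mulrA -exprSr ler_wpM2r ?powR_ge0// ler_nat size_map.
  apply: leq_trans (size_hz_box_ge _).
  by rewrite -expnM (mulnC j) expnM.
have : (v `^ q * r ^+ j) `^ q^-1 <= coc_norm g.
  rewrite /coc_norm pnorm.unlock ge0_ler_powR ?nnegrE ?invr_ge0 ?(ltW q0) ?fine_psum_ge0//.
    by rewrite mulr_ge0 ?powR_ge0 ?exprn_ge0 ?powR_ge0.
  by rewrite -lee_fin psum_fine//; exact: lp_bump_coc.
apply: le_trans.
rewrite powRM ?powR_ge0 ?exprn_ge0 ?powR_ge0// -powRrM mulfV ?gt_eqF// powRr1 ?(ltW v0)//.
have -> : (r ^+ j) `^ q^-1 = ((2 ^ j)%:R) `^ (1 - e).
  rewrite /r -(powR_mulrn _ (powR_ge0 _ _)) -!powRrM natrX -(powR_mulrn j (ler0n R 2)) -powRrM.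
  by congr (_ `^ _); field; rewrite gt_eqF.
have v32 : 1 / 32 <= v.
  have -> : 1 / 32 = 2 `^ (- 5) :> R.
    by rewrite powRN -[5]/(5%:R) powR_mulrn// mul1r -natrX.
  rewrite ler_powR ?ler1n// lerN2.
  have q4 : 4 / q <= 4 by rewrite ler_pdivrMr//; move: q1; lra.
  by apply: le_trans (lerD (ltW e1) q4) _; rewrite nat1r ler_nat.
have : (gauge g)%:R `^ (1 - e) <= 12 * (2 ^ j)%:R `^ (1 - e) :> R.
  apply: (@le_trans _ _ ((12 * 2 ^ j)%:R `^ (1 - e))).
    by rewrite ge0_ler_powR ?nnegrE ?ler0n ?subr_ge0 ?(ltW e1)// ler_nat ltnW.
  rewrite natrM powRM ?ler0n// ler_wpM2r ?powR_ge0//.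
  by rewrite ler1_powR ?ler1n// lerBlDl lerDr ltW.
have : 0 <= (2 ^ j)%:R `^ (1 - e) :> R by exact: powR_ge0.
move: ((2 ^ j)%:R `^ _) ((gauge g)%:R `^ _) => A B A0 BA.
apply: (@le_trans _ _ (1 / 32 * A)); first by lra.
by rewrite ler_wpM2r.
Qed.

End cocycle.

(** * The cocycle norm as a length, and its behaviour under dilation *)

Section scaling.
Context (R : realType) (q e : R).
Hypotheses (q1 : 1 <= q) (e0 : 0 < e) (e1 : e < 1) (eq1 : 1 <= (1 - e) * q).
Let q0 : 0 < q. Proof. exact: lt_le_trans q1. Qed.
Let lpc g : lp q (bump_coc q e g). Proof. exact: lp_bump_coc. Qed.
Let v : R := weight_base q e.
Let v0 : 0 < v. Proof. exact: powR_gt0. Qed.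
Local Notation N := (coc_norm q e).
Local Notation cc := (bump_coc q e).
Let kap : R := 2 `^ (1 - e).

Lemma coc_norm_ge0 g : 0 <= N g.
Proof. exact: pnorm_ge0. Qed.

(** The cocycle identity, together with the invariance of the l_q norm under translation of the
    index. *)
Lemma coc_normM g h : N (hzmul g h) <= N g + N h.
Proof.
have tb := translate_bij (hzinv g).
have -> : N (hzmul g h) =
    pnorm q (fun t => (cc h \o (fun t => (t.1, hzmul (hzinv g) t.2))) t + cc g t).
  by apply: pnorm_eq => -[k x]; rewrite bump_cocM.
apply: le_trans (pnormD q1 (lp_reindex tb (lpc h)) (lpc g)) _.
by rewrite -pnorm_reindex// addrC.
Qed.

Lemma coc_normV g : N (hzinv g) = N g.
Proof.
rewrite /coc_norm (pnorm_reindex q (cc g) (translate_bij g)).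
by apply: pnorm_eq => -[k x] /=; rewrite bump_cocV normrN.
Qed.

Lemma coc_norm1 : N hz1 = 0.
Proof.
rewrite /coc_norm (_ : cc hz1 = fun=> 0).
  by rewrite pnorm.unlock psum0 ?(gt_eqF q0)// powR0// invr_eq0 (gt_eqF q0).
by apply/funext => -[k x]; rewrite /bump_coc /= hzmul1 subrr mulr0.
Qed.

Definition coset : finType := ('I_2 * 'I_2 * 'I_4)%type.

Definition coset_rep (c : coset) : hz := ((c.1.1 : nat)%:Z, (c.1.2 : nat)%:Z, (c.2 : nat)%:Z).

Definition dilate_coset (t : hz * coset) : hz := hzmul (dilate t.1) (coset_rep t.2).

(** The coordinates x and y are divided by 2, then z by 4 after removing the twist 2 x' b that the
    product creates, for x' the quotient of x and b the remainder of y. *)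
Lemma dilate_coset_bij : bijective dilate_coset.
Proof.
pose f (g : hz) : hz * coset :=
  let x := ediv 1%N g.1.1 in let y := ediv 1%N g.1.2 in
  let z := ediv 3%N (g.2 - 2 * x.1 * (y.2 : nat)%:Z) in
  ((x.1, y.1, z.1), (x.2, y.2, z.2)).
exists f.
  have e2 (x : int) (a : 'I_2) : ediv 1%N (2 * x + (a : nat)%:Z) = (x, a).
    exact: (@emulK _ (x, a)).
  have e4 (x : int) (a : 'I_4) : ediv 3%N (4 * x + (a : nat)%:Z) = (x, a).
    exact: (@emulK _ (x, a)).
  move=> [[[x y] z] [[a b] c]].
  lazy beta iota zeta delta [f dilate_coset hzmul dilate coset_rep fst snd].
  by rewrite !e2; lazy beta iota; rewrite addrK e4.
have e2 (x : int) : 2 * (ediv 1%N x).1 + ((ediv 1%N x).2 : nat)%:Z = x by exact: edivK.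
have e4 (x : int) : 4 * (ediv 3%N x).1 + ((ediv 3%N x).2 : nat)%:Z = x by exact: edivK.
move=> [[x y] z].
rewrite -[dilate_coset _]/(2 * (ediv 1%N x).1 + ((ediv 1%N x).2 : nat)%:Z,
  2 * (ediv 1%N y).1 + ((ediv 1%N y).2 : nat)%:Z,
  4 * (ediv 3%N (z - 2 * (ediv 1%N x).1 * ((ediv 1%N y).2 : nat)%:Z)).1 +
  ((ediv 3%N (z - 2 * (ediv 1%N x).1 * ((ediv 1%N y).2 : nat)%:Z)).2 : nat)%:Z +
  2 * (ediv 1%N x).1 * ((ediv 1%N y).2 : nat)%:Z).
by rewrite !e2 e4 subrK.
Qed.

Lemma gauge_coset_rep c : (gauge (coset_rep c) <= 2)%N.
Proof.
rewrite gauge_le; case: c => [[[a a2] [b b2]] [c c4]]; rewrite /hz_fits /=.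
by apply/and3P; split; lia.
Qed.

Lemma gauge_coset_repV c : (gauge (hzinv (coset_rep c)) <= 2)%N.
Proof.
rewrite gauge_le; case: c => [[[a a2] [b b2]] [c c4]]; rewrite /hz_fits /=.
by apply/and3P; split; [lia|lia|]; move: a b a2 b2 => [|[|a]] [|[|b]] //= _ _; lia.
Qed.

Lemma gauge_dilate_coset t :
  (gauge (dilate_coset t) <= 2 * gauge t.1 + 2)%N &&
  (2 * gauge t.1 <= gauge (dilate_coset t) + 3)%N.
Proof.
rewrite /dilate_coset; have h1 := gaugeM (dilate t.1) (coset_rep t.2).
have h2 := gaugeM (hzmul (dilate t.1) (coset_rep t.2)) (hzinv (coset_rep t.2)).
rewrite -hzmulA hzmulrV hzmulr1 in h2.
have h3 := gauge_coset_rep t.2; have h4 := gauge_coset_repV t.2.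
have h5 := gauge_dilate_le t.1; have h6 := gauge_dilate_ge t.1.
by apply/andP; split; lia.
Qed.

(** Scale 0 has no predecessor; the value 0 there costs at most 1, within the error of
    [bump_dilate]. *)
Definition prev_bump (k : nat) (h : hz) : nat := if k is k'.+1 then 2 * bump k' h else 0.

Definition bump_error (t : nat * hz) : R := v ^+ t.1 * (3 * (gauge t.2 <= 3 * 2 ^ t.1)%N%:R).

(** The gauge of [dilate_coset t] differs from twice that of [t.1] by at most 3, and when the latter
    exceeds 3 2^k both bumps vanish. *)
Lemma bump_dilate k t :
  v ^+ k * `|(bump k (dilate_coset t))%:R - (prev_bump k t.1)%:R| <= bump_error (k, t.1).
Proof.
rewrite /bump_error ler_wpM2l ?exprn_ge0 ?(ltW v0)//= natr_dist -[3]/(3%:R) -natrM ler_nat.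
have /andP[h1 h2] := gauge_dilate_coset t; rewrite /prev_bump /bump.
move: (gauge (dilate_coset t)) (gauge t.1) h1 h2 => G G1 h1 h2.
case: k => [|k]; [rewrite expn0|rewrite expnS; move: (2 ^ k)%N => a].
  by have [h3|h3] := leqP G1 (3 * 1); rewrite /= ?muln1 ?muln0; lia.
by have [h3|h3] := leqP G1 (3 * (2 * a)); rewrite /= ?muln1 ?muln0; lia.
Qed.

Lemma lp_bump_error : lp q bump_error.
Proof.
pose s : R := 2 `^ (- (e * q)).
have s0 : 0 < s by exact: powR_gt0.
have s1 : s < 1 by rewrite powR2N_lt1// mulr_gt0.
have [n nE] : exists n, n = (27 * 81)%N by exists (27 * 81)%N.
pose c k : R := n%:R * 3 `^ q * s ^+ k.
apply: (@le_lt_trans _ _ (n%:R * 3 `^ q * (1 - s)^-1)%:E); last exact: ltry.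
apply: (@psum_natpair_le _ _ _ _ _ c) => [k|N]; last first.
  rewrite /c -mulr_sumr; apply: ler_wpM2l; first by apply: mulr_ge0 => //; exact: powR_ge0.
  by apply: sum_geom_lt1; rewrite s0.
pose L := hz_box (3 * 2 ^ k).
apply: (@le_trans _ _ ((size L)%:R * (v ^+ k * 3) `^ q)%:E).
  apply: psum_supp => // h; rewrite /bump_error /=.
    by rewrite mem_hz_box; case: leqP => // _; rewrite !mulr0 eqxx.
  rewrite ger0_norm ?mulr_ge0 ?exprn_ge0 ?(ltW v0)// ler_wpM2l ?exprn_ge0 ?(ltW v0)//.
  by case: leqP => _; rewrite ?mulr1 ?mulr0.
rewrite lee_fin; apply: le_trans (_ : (n * 16 ^ k)%:R * (v ^+ k * 3) `^ q <= _).
  rewrite ler_wpM2r ?powR_ge0// ler_nat.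
  have := @size_hz_box_le (3 * 2 ^ k); rewrite muln_gt0 expn_gt0 => /(_ isT).
  by rewrite expnMn -expnM (mulnC k) expnM -[(2 ^ 4)%N]/16%N -[(3 ^ 4)%N]/81%N mulnA nE.
by rewrite (weight_powR e q1)// /c mulrAC.
Qed.

(* The image of dilate has index 16. Writing h = dilate h' * c with c in a
   transversal, the terms of scale k of the cocycle of dilate g are those of
   scale k - 1 of the cocycle of g, up to the summable error bump_error. *)
Lemma coc_norm_dilate : exists K : R, 0 <= K /\ forall g, `|N (dilate g) - kap * N g| <= K.
Proof.
pose err (t : nat * hz * coset) := bump_error t.1.
have lpe : lp q err by apply: lp_fst; exact: lp_bump_error.
exists (2 * pnorm q err); split; first by rewrite mulr_ge0 ?pnorm_ge0.
move=> g.
pose X (t : nat * hz * coset) := cc (dilate g) (t.1.1, dilate_coset (t.1.2, t.2)).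
pose Y0 (t : nat * hz) : R := v ^+ t.1 *
  ((prev_bump t.1 (hzmul (hzinv g) t.2))%:R - (prev_bump t.1 t.2)%:R).
pose Y (t : nat * hz * coset) := Y0 t.1.
pose errg (t : nat * hz * coset) := bump_error (t.1.1, hzmul (hzinv g) t.1.2).
have tb := translate_bij (hzinv g).
have lpeg0 := lp_reindex tb lp_bump_error.
have lpeg : lp q errg := lp_fst coset lpeg0.
have pneg : pnorm q errg = pnorm q err.
  rewrite (pnorm_fst _ q0 lpeg0) (pnorm_fst _ q0 lp_bump_error).
  by congr (_ * _); rewrite -pnorm_reindex.
have bX : bijective (fun t : nat * hz * coset => (t.1.1, dilate_coset (t.1.2, t.2))).
  have [f fK Kf] := dilate_coset_bij.
  exists (fun t => (t.1, (f t.2).1, (f t.2).2)) => [[[k h] c]|[k h]] /=; first by rewrite fK.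
  by rewrite -surjective_pairing Kf.
have lpX : lp q X := lp_reindex bX (lpc _).
have pnX : N (dilate g) = pnorm q X by rewrite [LHS](pnorm_reindex _ _ bX).
have pY0 : psum q Y0 = psum q (fun t => 2 * v * cc g t).
  rewrite (@psum_inj _ _ _ _ (fun t : nat * hz => (t.1.+1, t.2))) ?(gt_eqF q0)//.
  - apply: psum_eq => -[k h]; rewrite /Y0 /bump_coc /= !natrM exprS; congr `|_|.
    by rewrite -/v; ring.
  - by move=> [k h] [k' h'] /= [-> ->].
  - move=> [[|k] h] nt; first by rewrite /Y0 /= subrr mulr0.
    by case: nt; exists (k, h).
have lpY0 : lp q Y0 by rewrite /lp pY0; exact: lpZ.
have lpY : lp q Y := lp_fst coset lpY0.
have pnY : pnorm q Y = kap * N g.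
  rewrite (pnorm_fst _ q0 lpY0).
  have -> : pnorm q Y0 = 2 * v * N g.
    have -> : pnorm q Y0 = pnorm q (fun t => 2 * v * cc g t) by rewrite !pnorm.unlock pY0.
    by rewrite pnormZ// ger0_norm// mulr_ge0// ltW.
  (* The factor kap is 16^(1/q) 2 v: sixteen cosets, the doubling of the bumps and the shift by one
     scale; the terms 4/q cancel. *)
  rewrite mulrA; congr (_ * _); rewrite !card_prod !card_ord.
  rewrite mulrCA /kap /v /weight_base.
  have -> : (2 * 2 * 4)%N%:R = 2 `^ 4 :> R by rewrite -[4 in RHS]/(4%:R) powR_mulrn// -natrX.
  rewrite -powRrM -{1}(@powRr1 _ 2)// -!powRD ?pnatr_eq0 ?implybT//.
  by congr (_ `^ _); ring.
rewrite pnX -pnY; apply: le_trans (pnorm_dist q1 lpX lpY) _.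
apply: (@le_trans _ _ (pnorm q (fun t => errg t + err t))).
  apply: le_pnorm => //; last by apply: lpD.
  move=> [[k h] c]; rewrite /X /Y /Y0 /errg /err /bump_coc /=.
  have := bump_dilate k (hzmul (hzinv g) h, c); have := bump_dilate k (h, c).
  have -> : hzmul (hzinv (dilate g)) (dilate_coset (h, c)) = dilate_coset (hzmul (hzinv g) h, c).
    by rewrite /dilate_coset /= hzmulA -dilateV -dilateM.
  rewrite -mulrBr normrM ger0_norm ?exprn_ge0 ?(ltW v0)//.
  move=> h1 h2; rewrite [leRHS]ger0_norm; last first.
    by rewrite addr_ge0// mulr_ge0 ?exprn_ge0 ?(ltW v0)// mulr_ge0.
  apply: le_trans (lerD h2 h1); rewrite -mulrDr ler_wpM2l ?exprn_ge0 ?(ltW v0)//.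
  by apply: le_trans (ler_normB _ _); rewrite le_eqVlt; apply/predU1P; left; congr `|_|; ring.
by apply: le_trans (pnormD q1 lpeg lpe) _; rewrite pneg; lra.
Qed.

End scaling.

(** * Renormalisation along iterated dilations *)

Section sigma.
Context (R : realType) (q e : R).
Hypotheses (q1 : 1 <= q) (e0 : 0 < e) (e1 : e < 1) (eq1 : 1 <= (1 - e) * q).
Let q0 : 0 < q. Proof. exact: lt_le_trans q1. Qed.
Let kap : R := 2 `^ (1 - e).
Let kap0 : 0 < kap. Proof. exact: powR_gt0. Qed.

Definition sigma (n : nat) (g : hz) : R := (kap ^+ n)^-1 * coc_norm q e (iter n dilate g).

Let kapX j : kap ^+ j = 2 `^ (j%:R * (1 - e)).
Proof. by rewrite /kap -(powR_mulrn _ (powR_ge0 _ _)) -powRrM mulrC. Qed.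

Let kapXi n : 0 < (kap ^+ n)^-1. Proof. by rewrite invr_gt0 exprn_gt0. Qed.

Lemma kap_gt1 : 1 < kap.
Proof. by rewrite powR2_gt1// subr_gt0. Qed.

Lemma sigmaM n g h : sigma n (hzmul g h) <= sigma n g + sigma n h.
Proof. by rewrite /sigma iter_dilateM -mulrDr ler_wpM2l ?(ltW (kapXi n))// coc_normM. Qed.

Lemma sigmaV n g : sigma n (hzinv g) = sigma n g.
Proof. by rewrite /sigma iter_dilateV coc_normV. Qed.

Lemma sigma1 n : sigma n hz1 = 0.
Proof.
rewrite /sigma (_ : iter n dilate hz1 = hz1) ?coc_norm1 ?mulr0//.
by elim: n => //= n ->; rewrite /dilate /= !mulr0.
Qed.

Lemma sigma_ge0 n g : 0 <= sigma n g.
Proof. by rewrite mulr_ge0 ?coc_norm_ge0// ltW. Qed.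

Lemma coc_norm_iter : exists K : R, 0 <= K /\
  forall j g, `|coc_norm q e (iter j dilate g) - kap ^+ j * coc_norm q e g| <= K * kap ^+ j.
Proof.
have [K [K0 normK]] := coc_norm_dilate q1 e0 e1 eq1.
have k1 : 0 < kap - 1 by rewrite subr_gt0 kap_gt1.
have K'0 : 0 <= K / (kap - 1) by rewrite divr_ge0// ltW.
exists (K / (kap - 1)); split => // j g; set K' := K / (kap - 1) in K'0 *.
(* Subtracting 1 closes the induction: kap K' (kap^j - 1) + K is exactly K' (kap^(j+1) - 1), because
   K = K' (kap - 1). *)
suff h : `|coc_norm q e (iter j dilate g) - kap ^+ j * coc_norm q e g| <= K' * (kap ^+ j - 1).
  by apply: le_trans h _; rewrite ler_wpM2l// gerBl.
elim: j => [|j IH] /=; first by rewrite expr0 mul1r !subrr normr0 mulr0.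
have -> : coc_norm q e (dilate (iter j dilate g)) - kap ^+ j.+1 * coc_norm q e g =
    (coc_norm q e (dilate (iter j dilate g)) - kap * coc_norm q e (iter j dilate g)) +
    kap * (coc_norm q e (iter j dilate g) - kap ^+ j * coc_norm q e g).
  by rewrite exprS; ring.
apply: le_trans (ler_normD _ _) _.
rewrite [X in _ + X]normrM (gtr0_norm kap0).
have -> : K' * (kap ^+ j.+1 - 1) = K + kap * (K' * (kap ^+ j - 1)).
  have -> : K = K' * (kap - 1) by rewrite divfK// gt_eqF.
  by rewrite exprS; ring.
by apply: lerD; [exact: normK|rewrite ler_wpM2l// ltW].
Qed.

Lemma sigma_iter : exists K : R, 0 <= K /\
  forall n j g, `|sigma n (iter j dilate g) - 2 `^ (j%:R * (1 - e)) * sigma n g|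
    <= (kap ^+ n)^-1 * K * 2 `^ (j%:R * (1 - e)).
Proof.
have [K [K0 normK]] := coc_norm_iter; exists K; split => // n j g.
rewrite -kapX /sigma -iterD addnC iterD mulrCA -mulrBr normrM gtr0_norm//.
by rewrite -mulrA ler_wpM2l ?(ltW (kapXi n)).
Qed.

(** Unlike [coc_norm_ge], it covers every gauge: for n >= 4 a nontrivial element is dilated to gauge
    at least 8. The factor 1/2 comes from [gauge_iter_dilate_ge]. *)
Lemma sigma_ge n g : (4 <= n)%N -> (gauge g)%:R `^ (1 - e) / 2 / 384 <= sigma n g.
Proof.
move=> n4; have [g0|g0] := posnP (gauge g).
  by rewrite g0 powR0 ?mul0r ?mul0r ?sigma_ge0// gt_eqF// subr_gt0.
rewrite /sigma ler_pdivlMl ?exprn_gt0//.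
have h := gauge_iter_dilate_ge n g; have n16 : (16 <= 2 ^ n)%N by rewrite (@leq_pexp2l 2 4).
have h6 : (6 <= gauge (iter n dilate g))%N by nia.
apply: le_trans (coc_norm_ge q1 e0 e1 eq1 h6).
have i0 : 0 <= 384^-1 :> R by rewrite invr_ge0 ler0n.
move: (384^-1 : R) i0 => i i0; rewrite mulrA mulrA; apply: ler_wpM2r => //.
rewrite ler_pdivrMr//.
rewrite kapX powRrM powR_mulrn// -powRM ?exprn_ge0 ?ler0n//.
rewrite -natrX -natrM; apply: (@le_trans _ _ ((2 * gauge (iter n dilate g))%:R `^ (1 - e))).
  by rewrite ge0_ler_powR ?nnegrE ?ler0n ?subr_ge0 ?(ltW e1)// ler_nat.
rewrite natrM powRM ?ler0n// mulrC ler_wpM2l ?powR_ge0//.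
by rewrite ler1_powR ?ler1n// lerBlDl lerDr ltW.
Qed.

Lemma sigma_le n g :
  sigma n g <= (162 * 2 `^ q / e) `^ q^-1 * (gauge g)%:R `^ (1 - e).
Proof.
have e1' : 0 <= 1 - e by rewrite subr_ge0 ltW.
rewrite /sigma ler_pdivrMl ?exprn_gt0//.
have C0 : 0 <= 162 * 2 `^ q / e by rewrite divr_ge0 ?(ltW e0)// mulr_ge0 ?powR_ge0.
have h : coc_norm q e (iter n dilate g) <=
    (162 * 2 `^ q / e) `^ q^-1 * (gauge (iter n dilate g))%:R `^ (1 - e).
  have -> : (gauge (iter n dilate g))%:R `^ (1 - e) =
      ((gauge (iter n dilate g))%:R `^ ((1 - e) * q)) `^ q^-1.
    by rewrite -powRrM mulfK// gt_eqF.
  rewrite -powRM ?powR_ge0// /coc_norm pnorm.unlock.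
  apply: ge0_ler_powR; rewrite ?nnegrE ?invr_ge0 ?(ltW q0) ?fine_psum_ge0//.
    by apply: mulr_ge0 => //; exact: powR_ge0.
  by rewrite -lee_fin psum_fine; [exact: psum_bump_coc_le|exact: lp_bump_coc].
apply: le_trans h _; rewrite mulrCA ler_wpM2l ?powR_ge0//.
rewrite kapX powRrM powR_mulrn// -powRM ?exprn_ge0 ?ler0n//.
by rewrite ge0_ler_powR ?nnegrE ?mulr_ge0 ?exprn_ge0// -natrX -natrM ler_nat gauge_iter_dilate_le.
Qed.

End sigma.

(** * Doubling *)

Lemma gauge0 g : gauge g = 0%N -> g = hz1.
Proof.
have := gauge_fits g; move=> + g0; rewrite g0 /hz_fits; case: g g0 => [[x y] z] _ /=.
by rewrite !leqn0 !absz_eq0 => /and3P[/eqP -> /eqP -> /eqP ->].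
Qed.

Section doubling_range.
Context (R : realType) (T : Type) (d : T -> T -> R) (F : heis -> T) (sg : hz -> R).
Context (c gam eta th A B : R).
Hypotheses (sgM : forall g h, sg (hzmul g h) <= sg g + sg h)
  (sgV : forall g, sg (hzinv g) = sg g) (sg1 : sg hz1 = 0)
  (c0 : 0 < c) (gam0 : 0 < gam)
  (sg_ge : forall g, c * (gauge g)%:R `^ gam <= sg g)
  (sg_dil : forall j g,
    `|sg (iter j dilate g) - 2 `^ (j%:R * gam) * sg g| <= eta * 2 `^ (j%:R * gam))
  (eta0 : 0 <= eta) (th0 : 0 < th) (A0 : 0 < A) (AB : A <= B)
  (dF : forall x y, let u := hzmul (hzinv (coord x)) (coord y) in
    A * sg u `^ th <= d (F x) (F y) <= B * sg u `^ th).
(** Halving the radius and passing from the lower constant A to the upper one B amounts to dividing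
    [sg] by Y. *)
Let Y := (2 * B / A) `^ th^-1.
Hypothesis slack : eta * (16 `^ gam + 1) * Y <= (16 `^ gam - 2 * Y - 1) * c.
Hypothesis Y16 : 2 * Y + 1 < 16 `^ gam.

Let B0 : 0 < B. Proof. exact: lt_le_trans AB. Qed.
Let sg0 g : 0 <= sg g.
Proof. by apply: le_trans (sg_ge g); rewrite mulr_ge0 ?powR_ge0// ltW. Qed.
Let Y0 : 0 < Y. Proof. by rewrite powR_gt0// divr_gt0// mulr_gt0. Qed.
Let thi0 : 0 < th^-1. Proof. by rewrite invr_gt0. Qed.

Let powR_thK a : 0 <= a -> (a `^ th^-1) `^ th = a.
Proof. by move=> a0; rewrite -powRrM mulVf ?gt_eqF// powRr1. Qed.

(** After translation to the identity, a maximal separated subset of the ball supplies the centres,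
    and [packing_bound] limits their number. The additive error [eta] is harmless: balls with
    [rr < c] are single points, since [sg] is at least [c] off the identity. *)
Lemma doubling_range : doubling d (range F) (2 ^+ 16).
Proof.
move=> x r [x0 _ <-] r0.
have dxx x1 : d (F x1) (F x1) <= 0.
  have /andP[_] := dF x1 x1; rewrite hzmulV sg1 powR0 ?gt_eqF// mulr0; exact.
have thP a b : 0 <= a -> 0 <= b -> (a `^ th <= b `^ th) = (a <= b).
  move=> a0 b0; apply/idP/idP => h; last by rewrite ge0_ler_powR ?nnegrE ?(ltW th0).
  by rewrite leNgt; apply/negP => ba; move: h; rewrite leNgt gt0_ltr_powR ?nnegrE.
pose rr := (r / A) `^ th^-1.
have rA0 : 0 <= r / A by rewrite divr_ge0// ltW.
have rr0 : 0 <= rr by exact: powR_ge0.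
have ball_sg y : d (F x0) (F y) <= r -> sg (hzmul (hzinv (coord x0)) (coord y)) <= rr.
  move=> yr; rewrite -thP// powR_thK// ler_pdivlMr// mulrC.
  by apply: le_trans yr; have /andP[] := dF x0 y.
have [rc|cr] := ltP rr c.
  exists 1%N, (fun=> F x0); split.
  - by rewrite -natrX ler_nat expn_gt0.
  - by move=> _; exists x0.
  - move=> _ [[y _ <-]] /= /ball_sg yr; exists ord0 => //.
    suff -> : y = x0 by apply: le_trans (dxx x0) _; rewrite divr_ge0.
    have := le_lt_trans (le_trans (sg_ge _) yr) rc.
    rewrite -[X in _ < X]mulr1 ltr_pM2l//.
    case: (posnP (gauge (hzmul (hzinv (coord x0)) (coord y)))).
      move=> g0 _; have /gauge0 := g0; rewrite -coordV -coordM -coord1 => /coord_inj e.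
      by rewrite -[y]mul1g -(mulgV x0) -mulgA e mulg1.
    move=> g0; rewrite ltNge => /negP[].
    have : (1 : R) `^ gam <= (gauge (hzmul (hzinv (coord x0)) (coord y)))%:R `^ gam.
      by rewrite ge0_ler_powR ?nnegrE ?(ltW gam0)// ler1n.
    by rewrite powR1.
(* Chosen so that B tau^th = r / 2. *)
pose tau := rr / Y.
have tauY : tau * Y = rr by rewrite divfK// gt_eqF.
have tau0 : 0 <= tau by rewrite divr_ge0// ltW.
have rr_pos : 0 < rr by exact: lt_le_trans cr.
(* [slack] is this condition at rr = c, multiplied by Y; by [Y16] its right side only grows with
   rr. *)
have r_tau : 2 * rr + tau + eta <= 16 `^ gam * (tau - eta).
  have : eta * (16 `^ gam + 1) * Y <= (16 `^ gam - 2 * Y - 1) * rr.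
    by apply: le_trans slack _; rewrite ler_wpM2l//; move: Y16; lra.
  rewrite -tauY mulrA ler_pM2r//.
  by move: (16 `^ gam) => z; lra.
have tau_eta : eta < tau.
  have : 0 < 16 `^ gam * (tau - eta).
    by apply: lt_le_trans r_tau; rewrite -addrA ltr_wpDr ?addr_ge0// mulr_gt0.
  by rewrite pmulr_rgt0 ?powR_gt0// subr_gt0.
pose P m := `[< exists s : seq hz, [/\ uniq s, size s = m, forall g, g \in s -> sg g <= rr &
  forall g h, g \in s -> h \in s -> g != h -> tau < sg (hzmul (hzinv g) h)] >].
have P0 : exists m, P m by exists 0%N; apply/asboolP; exists [::].
have Pb m : P m -> (m <= 2 ^ 16)%N.
  move=> /asboolP[s [us <- sr ss]].
  exact: (packing_bound sgM sgV sg1 c0 gam0 sg_ge sg_dil tau_eta r_tau us sr ss).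
case: (ex_maxnP P0 Pb) => m Pm mmax.
have /asboolP[s [us sm sr ss]] := Pm.
exists (size s), (fun i : 'I_(size s) => F (x0 * heis_nf (nth hz1 s i))%g); split.
- by rewrite -natrX ler_nat sm Pb.
- by move=> i; eexists.
move=> _ [[y _ <-]] /= /ball_sg.
set g := hzmul _ _ => gr.
have [[h [hs hg]]|no] := pselect (exists h, h \in s /\ sg (hzmul (hzinv h) g) <= tau).
  have hi : (index h s < size s)%N by rewrite index_mem.
  exists (Ordinal hi) => //=; rewrite /cball /= nth_index//.
  have /andP[_] := dF (x0 * heis_nf h)%g y; rewrite coordM heis_nfK hzinvM -hzmulA -/g.
  move=> /le_trans; apply; rewrite mulrC -ler_pdivlMr//.
  apply: (@le_trans _ _ (tau `^ th)); first by rewrite thP.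
  rewrite /tau powRM ?invr_ge0 ?(ltW Y0)// powR_thK//.
  have BA0 : 0 < 2 * B / A by rewrite divr_gt0// mulr_gt0.
  have -> : Y^-1 `^ th = (2 * B / A)^-1.
    apply: (mulIf (lt0r_neq0 BA0)); rewrite [RHS]mulVf ?gt_eqF//.
    rewrite -{1}(powR_thK (ltW BA0)) -/Y -powRM ?invr_ge0 ?(ltW Y0)//.
    by rewrite mulVf ?gt_eqF// powR1.
  by rewrite le_eqVlt; apply/predU1P; left; field; rewrite !gt_eqF.
(* A point of the ball that no centre covers could be added to the separated set, against
   maximality. *)
have : P m.+1.
  apply/asboolP; exists (g :: s).
  have gN h : h \in s -> tau < sg (hzmul (hzinv h) g).
    by move=> hs; rewrite ltNge; apply/negP => hg; apply: no; exists h.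
  split => //=.
  - rewrite us andbT; apply/negP => /gN; rewrite hzmulV sg1; apply/negP.
    by rewrite -leNgt.
  - by rewrite sm.
  - by move=> h; rewrite inE => /predU1P[->|/sr].
  - move=> a b; rewrite !inE => /predU1P[->|sa] /predU1P[->|sb]; rewrite ?eqxx//.
    + by move=> _; rewrite -sgV hzinvM hzinvK gN.
    + by move=> _; exact: gN.
    + exact: ss.
by move=> /mmax; rewrite ltnn.
Qed.

End doubling_range.

(** * The embedding *)

Section lift.
Context (R : realType) (I J : choiceType) (p th del : R) (psi : int -> J -> R)
  (a b : I -> int) (w : I -> R).
Hypotheses (p0 : 0 < p) (th0 : 0 < th) (del0 : 0 <= del)
  (psiP : snowflake p th del psi) (w0 : forall i, 0 <= w i).

Let z i := w i * `|a i - b i|%N%:R.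
Let x (t : I * J) := w t.1 `^ th * (psi (a t.1) t.2 - psi (b t.1) t.2).

(** Summing over the second index first, the p-th power of the norm of psi a - psi b is |a - b|^(p
    th) up to (1 + del)^p. Composition with [psi] thus replaces an l_(p th) norm by essentially its
    th-th power. *)
Lemma psum_lift : (psum (p * th) z <= psum p x <= ((1 + del) `^ p)%:E * psum (p * th) z)%E.
Proof.
have zE i : `|z i| `^ (p * th) = (w i `^ th) `^ p * (`|a i - b i|%N%:R `^ th) `^ p.
  rewrite ger0_norm ?mulr_ge0//; rewrite /z powRM ?w0 ?ler0n// -!powRrM.
  by rewrite (mulrC th).
have xE i : psum p (fun j => x (i, j)) =
    ((w i `^ th) `^ p * pnorm p (fun j => psi (a i) j - psi (b i) j) `^ p)%:E.
  have [lpp _] := psiP (a i) (b i).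
  rewrite /x /= (psumZ p _ (fun j => psi (a i) j - psi (b i) j)).
  by rewrite ger0_norm ?powR_ge0// -psum_fine// -EFinM powR_pnorm ?gt_eqF.
have -> : psum (p * th) z = (\esum_(i in [set: I]) (`|z i| `^ (p * th))%:E)%E.
  by rewrite psum.unlock.
rewrite psum_pair; apply/andP; split.
  apply: le_esum => i _; rewrite xE zE lee_fin ler_wpM2l ?powR_ge0//.
  have [_ /andP[h _]] := psiP (a i) (b i).
  by rewrite ge0_ler_powR ?nnegrE ?powR_ge0 ?pnorm_ge0 ?(ltW p0).
rewrite -esumZ; last 2 first.
- exact: powR_ge0.
- by move=> i; rewrite lee_fin powR_ge0.
apply: le_esum => i _; rewrite xE zE -EFinM lee_fin mulrCA ler_wpM2l ?powR_ge0//.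
have [_ /andP[_ h]] := psiP (a i) (b i).
rewrite -powRM ?powR_ge0 ?addr_ge0//.
by rewrite ge0_ler_powR ?nnegrE ?pnorm_ge0 ?(ltW p0)// mulr_ge0 ?powR_ge0 ?addr_ge0.
Qed.

Lemma lp_lift : lp (p * th) z -> lp p x.
Proof.
move=> lz; have /andP[_ h] := psum_lift; apply: le_lt_trans h _.
by rewrite -psum_fine// -EFinM ltry.
Qed.

Lemma pnorm_lift : lp (p * th) z ->
  pnorm (p * th) z `^ th <= pnorm p x <= (1 + del) * pnorm (p * th) z `^ th.
Proof.
move=> lz; have lx := lp_lift lz; have /andP[h1 h2] := psum_lift.
have -> : pnorm (p * th) z `^ th = fine (psum (p * th) z) `^ p^-1.
  by rewrite pnorm.unlock -powRrM invfM mulfVK ?gt_eqF.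
have -> : pnorm p x = fine (psum p x) `^ p^-1 by rewrite pnorm.unlock.
move: h1 h2; rewrite -(psum_fine lz) -(psum_fine lx).
rewrite -EFinM !lee_fin => h1 h2; apply/andP; split.
  by rewrite ge0_ler_powR ?nnegrE ?fine_psum_ge0 ?invr_ge0 ?(ltW p0).
have d1 : 0 <= 1 + del by rewrite addr_ge0.
rewrite -[X in X * _](_ : ((1 + del) `^ p) `^ p^-1 = _); last first.
  by rewrite -powRrM mulfV ?gt_eqF// powRr1.
rewrite -powRM ?powR_ge0 ?fine_psum_ge0//.
rewrite ge0_ler_powR ?nnegrE ?fine_psum_ge0 ?invr_ge0 ?(ltW p0)//.
by rewrite mulr_ge0 ?powR_ge0 ?fine_psum_ge0.
Qed.

End lift.

Lemma exists_expr_ge (R : realType) (x B : R) (m : nat) : 1 < x ->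
  exists2 n, (m <= n)%N & B <= x ^+ n.
Proof.
move=> x1; have bern n : 1 + n%:R * (x - 1) <= x ^+ n.
  elim: n => [|n IH]; first by rewrite mul0r addr0 expr0.
  rewrite exprS; apply: (@le_trans _ _ (x * (1 + n%:R * (x - 1)))); last first.
    by rewrite ler_wpM2l// (le_trans _ (ltW x1)).
  have : 0 <= n%:R * (x - 1) ^+ 2 by rewrite mulr_ge0// sqr_ge0.
  by rewrite -natr1; lra.
have x10 : 0 < x - 1 by rewrite subr_gt0.
exists (m + (Num.truncn (`|B| / (x - 1))).+1)%N; first exact: leq_addr.
apply: le_trans (ler_norm B) _; apply: le_trans (bern _).
apply: (@le_trans _ _ ((Num.truncn (`|B| / (x - 1))).+1%:R * (x - 1))).
  by rewrite -ler_pdivrMr// ltW// truncnS_gt.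
by rewrite natrD mulrDl addrA lerDr addr_ge0// mulr_ge0// ltW.
Qed.

Section core.
Context (R : realType) (p th e del : R) (J : countType) (psi : int -> J -> R).
Hypotheses (p2 : 2 <= p) (th0 : 0 < th) (th1 : th <= 1) (q1 : 1 <= p * th)
  (e0 : 0 < e) (e1 : e < 1) (eq1 : 1 <= (1 - e) * (p * th))
  (del0 : 0 <= del) (del1 : del <= 1) (psiP : snowflake p th del psi).
Hypothesis gap : 2 * (2 * (1 + del)) `^ th^-1 + 1 < 16 `^ (1 - e).

Let q := p * th.
Let p0 : 0 < p. Proof. by apply: lt_le_trans p2. Qed.
Let p1 : 1 <= p. Proof. by apply: le_trans p2; rewrite ler1n. Qed.
Let v : R := weight_base q e.
Let v0 : 0 < v. Proof. exact: powR_gt0. Qed.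

(** Subtracting the untranslated value makes [feature hz1] zero, so that every [feature g] is in
    l_p, and leaves differences unchanged. *)
Definition feature (g : hz) (t : nat * hz * J) : R :=
  (v ^+ t.1.1) `^ th * (psi (bump t.1.1 (hzmul (hzinv g) t.1.2))%:Z t.2 -
                        psi (bump t.1.1 t.1.2)%:Z t.2).

Lemma feature_sub g g' t : feature g t - feature g' t =
  (v ^+ t.1.1) `^ th * (psi (bump t.1.1 (hzmul (hzinv g) t.1.2))%:Z t.2 -
                        psi (bump t.1.1 (hzmul (hzinv g') t.1.2))%:Z t.2).
Proof. by rewrite /feature; ring. Qed.

Lemma pnorm_feature g g' :
  lp p (fun t => feature g t - feature g' t) /\
  coc_norm q e (hzmul (hzinv g) g') `^ th <= pnorm p (fun t => feature g t - feature g' t)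
   <= (1 + del) * coc_norm q e (hzmul (hzinv g) g') `^ th.
Proof.
pose a (i : nat * hz) := (bump i.1 (hzmul (hzinv g) i.2))%:Z.
pose b (i : nat * hz) := (bump i.1 (hzmul (hzinv g') i.2))%:Z.
pose w (i : nat * hz) : R := v ^+ i.1.
have w0 i : 0 <= w i by rewrite exprn_ge0// ltW.
pose z i := w i * `|a i - b i|%N%:R.
have tb := translate_bij (hzinv g).
have zE i : `|z i| =
    `|(bump_coc q e (hzmul (hzinv g) g') \o (fun t => (t.1, hzmul (hzinv g) t.2))) i|.
  rewrite /z /bump_coc /= !normrM normr_nat -natr_dist distrC; congr (_ * `|_%:R - _|).
  by rewrite hzinvM hzinvK -hzmulA hzmulVK.
have lz : lp q z.
  rewrite /lp (psum_eq q zE) -psum_reindex//; exact: lp_bump_coc.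
have pz : pnorm q z = coc_norm q e (hzmul (hzinv g) g').
  by rewrite (pnorm_eq q zE) -pnorm_reindex.
have -> : (fun t => feature g t - feature g' t) = fun t : nat * hz * J =>
    w t.1 `^ th * (psi (a t.1) t.2 - psi (b t.1) t.2).
  by apply/funext => t; rewrite feature_sub.
split; first exact: (lp_lift p0 del0 psiP w0 lz).
by rewrite -pz; exact: (pnorm_lift p0 th0 del0 psiP w0 lz).
Qed.

Lemma lp_feature g : lp p (feature g).
Proof.
have -> : feature g = fun t => feature g t - feature hz1 t.
  apply/funext => t; rewrite -[LHS]subr0; congr (_ - _).
  by rewrite /feature /hzinv /= !oppr0 mulr0 addr0 hzmul1 subrr mulr0.
by have [] := pnorm_feature g hz1.
Qed.

Let gam0 : 0 < 1 - e. Proof. by rewrite subr_gt0. Qed.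
Let thi0 : 0 < th^-1. Proof. by rewrite invr_gt0. Qed.

(* Rescaling by a large power of the dilation makes the additive error of
   [sigma_iter] negligible compared with the values of sigma. *)
Lemma core_embedding : exists F : heis -> Lp01 (le1_of_le2 p2),
  doubling (@Lp_dist R p (le1_of_le2 p2)) (range F) (2 ^+ 16) /\
  forall x y : heis, (dW x y)%:R `^ ((1 - e) * th) <= Lp_dist (F x) (F y) <=
    2 * (12 * 2 * 384) * (162 * 2) * ((dW x y)%:R `^ ((1 - e) * th) / e `^ p^-1).
Proof.
have [K [K0 normK]] := sigma_iter q1 e0 e1 eq1.
have [c cE] : exists c : R, c = 1 / 2 / 384 by eexists.
have c0 : 0 < c by rewrite cE; lra.
have c1 : c <= 1 by rewrite cE; lra.
(* A is 12 / c: 1 / c = 2 384 is the constant of [sigma_ge] and 12 that of [heis_norm_le_gauge], so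
   that the lower bound in terms of [dW] has constant 1. *)
have [A AE] : exists A : R, A = 12 * 2 * 384 by eexists.
have A0 : 0 < A by rewrite AE; lra.
have Ac : A * c = 12 by rewrite AE cE; field.
have kap1 := kap_gt1 e1; set kap := 2 `^ (1 - e) in kap1.
pose Y := (2 * (1 + del)) `^ th^-1.
have [n n4 nK] : exists2 n, (4 <= n)%N &
    (kap ^+ n)^-1 * K * (16 `^ (1 - e) + 1) * Y <= (16 `^ (1 - e) - 2 * Y - 1) * c.
  have gap0 : 0 < (16 `^ (1 - e) - 2 * Y - 1) * c.
    by rewrite mulr_gt0//; move: gap; rewrite -/Y; lra.
  have [n n4 nB] := exists_expr_ge (K * (16 `^ (1 - e) + 1) * Y /
    ((16 `^ (1 - e) - 2 * Y - 1) * c)) 4 kap1.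
  exists n => //; rewrite -!mulrA ler_pdivrMl ?exprn_gt0 ?(lt_trans _ kap1)//.
  by move: nB; rewrite ler_pdivrMr// -!mulrA.
pose N : R := A * ((kap ^+ n)^-1) `^ th.
have kn0 : 0 < (kap ^+ n)^-1 by rewrite invr_gt0 exprn_gt0// (lt_trans _ kap1).
have N0 : 0 < N by rewrite mulr_gt0 ?powR_gt0.
have [E EP] := lp_Lp01 (le1_of_le2 p2) (nat * hz * J)%type.
pose F (x : heis) := E (fun t => N * feature (iter n dilate (coord x)) t).
have FP x y : let u := hzmul (hzinv (coord x)) (coord y) in
    A * sigma q e n u `^ th <= Lp_dist (F x) (F y) <= A * (1 + del) * sigma q e n u `^ th.
  rewrite /F EP; last 2 first.
  - by apply: lpZ; exact: lp_feature.
  - by apply: lpZ; exact: lp_feature.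
  set gx := iter n dilate (coord x); set gy := iter n dilate (coord y).
  have -> : (fun t => N * feature gx t - N * feature gy t) =
      (fun t => N * (feature gx t - feature gy t)).
    by apply/funext => t; rewrite mulrBr.
  rewrite pnormZ// gtr0_norm// /sigma iter_dilateM iter_dilateV -/gx -/gy.
  rewrite powRM ?coc_norm_ge0 ?(ltW kn0)// /N.
  have [_ /andP[h1 h2]] := pnorm_feature gx gy.
  rewrite mulrA ler_wpM2l ?(ltW N0)//=.
  apply: le_trans (ler_wpM2l (ltW N0) h2) _; rewrite /N le_eqVlt; apply/predU1P; left; ring.
exists F; split.
  apply: (@doubling_range R _ _ F (sigma q e n) c (1 - e) ((kap ^+ n)^-1 * K) th
    A (A * (1 + del))) => //.
  - by move=> g h; exact: sigmaM.
  - by move=> g; exact: sigmaV.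
  - exact: sigma1.
  - move=> g; apply: le_trans (sigma_ge q1 e0 e1 eq1 g n4).
    by rewrite cE mulrC mulrA mulrA mulr1.
  - by rewrite mulr_ge0// ltW.
  - by rewrite ler_peMr ?(ltW A0)// lerDl.
  - have -> : 2 * (A * (1 + del)) / A = 2 * (1 + del) by field; rewrite gt_eqF.
    exact: nK.
  - have -> : 2 * (A * (1 + del)) / A = 2 * (1 + del) by field; rewrite gt_eqF.
    exact: gap.
move=> x y; have /andP[h1 h2] := FP x y; set u := hzmul _ _ in h1 h2.
have uE : u = coord (x^-1 * y)%g by rewrite coordM coordV.
have u1 : (gauge u <= dW x y)%N by rewrite uE gauge_coord_le.
have u2 : (dW x y <= 12 * gauge u)%N by rewrite uE heis_norm_le_gauge.
have gth0 : 0 <= (1 - e) * th by rewrite mulr_ge0 ?(ltW gam0) ?(ltW th0).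
have gth1 : (1 - e) * th <= 1.
  by rewrite mulr_ile1 ?(ltW gam0) ?(ltW th0)// gerBl ltW.
have th01 : (0 <= th) && (th <= 1) by rewrite th1 ltW.
set al := (1 - e) * th in gth0 gth1 *.
have s1 : ((gauge u)%:R `^ (1 - e)) `^ th = (gauge u)%:R `^ al :> R by rewrite -powRrM.
have G0 : 0 <= (gauge u)%:R `^ al :> R by exact: powR_ge0.
have pow_small (t : R) (b : R) : 1 <= t -> b <= 1 -> t `^ b <= t.
  exact: ler1_powR.
apply/andP; split.
  apply: le_trans h1; apply: (@le_trans _ _ (12 * (gauge u)%:R `^ al)).
    apply: (@le_trans _ _ ((12 * gauge u)%:R `^ al)).
      by rewrite ge0_ler_powR ?nnegrE// ler_nat.
    by rewrite natrM powRM ?ler0n// ler_wpM2r// pow_small// ler1n.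
  rewrite -Ac -mulrA ler_wpM2l ?(ltW A0)//.
  apply: (@le_trans _ _ ((c * (gauge u)%:R `^ (1 - e)) `^ th)).
    rewrite powRM ?powR_ge0 ?(ltW c0)// s1 ler_wpM2r//.
    by rewrite ger1_powR// c0.
  rewrite ge0_ler_powR ?nnegrE ?(ltW th0) ?sigma_ge0 ?mulr_ge0 ?powR_ge0 ?(ltW c0)//.
  apply: le_trans (sigma_ge q1 e0 e1 eq1 u n4).
  by rewrite cE mulrC mulrA mulrA mulr1.
apply: le_trans h2 _.
have C0 : 0 <= 162 * 2 `^ q / e.
  by apply: divr_ge0; [apply: mulr_ge0 => //; exact: powR_ge0|exact: ltW].
have sth : sigma q e n u `^ th <= (162 * 2 `^ q / e) `^ p^-1 * (gauge u)%:R `^ al.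
  rewrite -s1; have -> : p^-1 = q^-1 * th by rewrite /q invfM mulfVK ?gt_eqF.
  rewrite powRrM -powRM ?powR_ge0//.
  rewrite ge0_ler_powR ?nnegrE ?(ltW th0) ?sigma_ge0 ?mulr_ge0 ?powR_ge0//.
  exact: (sigma_le q1 e0 e1 eq1).
have p01 : 0 <= p^-1 <= 1 by rewrite invr_ge0 (ltW p0) invf_le1.
(* As q / p = th <= 1, the factor 2^q costs at most 2 after the p-th root, whereas e keeps the
   exponent 1/p. *)
have Cp : (162 * 2 `^ q / e) `^ p^-1 <= 162 * 2 / e `^ p^-1.
  have C1 : 0 <= 162 * 2 `^ q by apply: mulr_ge0 => //; exact: powR_ge0.
  have ei0 : 0 <= e^-1 by rewrite invr_ge0 ltW.
  rewrite (powRM _ C1 ei0).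
  rewrite -(powR_inv1 (ltW e0)) -powRrM mulN1r powRN ler_wpM2r ?invr_ge0 ?powR_ge0//.
  rewrite powRM ?powR_ge0// ler_pM ?powR_ge0//.
    by rewrite pow_small ?ler1n//; case/andP: p01.
  rewrite -powRrM /q mulrAC mulfV ?gt_eqF// mul1r.
  by rewrite pow_small ?ler1n.
have Gd : (gauge u)%:R `^ al <= (dW x y)%:R `^ al :> R.
  by rewrite ge0_ler_powR ?nnegrE// ler_nat.
apply: (@le_trans _ _ (A * 2 * (162 * 2 / e `^ p^-1 * (dW x y)%:R `^ al))).
  apply: ler_pM.
  - by rewrite mulr_ge0 ?(ltW A0)// addr_ge0.
  - exact: powR_ge0.
  - by rewrite ler_wpM2l ?(ltW A0)//; move: del1; lra.
  - by apply: le_trans sth _; rewrite ler_pM ?powR_ge0.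
by rewrite AE le_eqVlt; apply/predU1P; left; ring.
Qed.

End core.

(** * Numerical inequalities and the two ranges of eps *)

Lemma lt5_16powR (R : realType) (g : R) : 3 / 5 <= g -> 5 < 16 `^ g.
Proof.
move=> g35; apply: lt_le_trans (_ : 16 `^ (3 / 5) <= _); last by rewrite ler_powR ?ler1n.
have e5 : 5 = (5 ^+ 5) `^ 5^-1 :> R.
  by rewrite -(powR_mulrn 5 (ler0n R 5)) -powRrM mulfV// powRr1.
rewrite [ltLHS]e5 powRrM powR_mulrn//; apply: gt0_ltr_powR; rewrite ?nnegrE ?exprn_ge0 ?invr_gt0//.
(* 5^5 = 3125 < 4096 = 16^3. *)
by rewrite -!natrX ltr_nat.
Qed.

(** 16^(3/4) = 8, and 2.2^3 = 10.648 is below 3.4^2 = 11.56, so the left side is at most 7.8. *)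
Lemma gap_16powR (R : realType) (g : R) : 3 / 4 <= g ->
  2 * (2 * (1 + 1 / 10)) `^ (2 / 3)^-1 + 1 < 16 `^ g.
Proof.
move=> g34; apply: lt_le_trans (_ : 16 `^ (3 / 4) <= _); last by rewrite ler_powR ?ler1n.
have -> : 16 `^ (3 / 4) = 8 :> R.
  have -> : 16 = 2 `^ 4 :> R by rewrite -[4 in RHS]/(4%:R) powR_mulrn// -natrX.
  rewrite -powRrM (_ : 4 * (3 / 4) = 3%:R); last by field.
  by rewrite powR_mulrn// -natrX.
have : (2 * (1 + 1 / 10)) `^ (2 / 3)^-1 <= 17 / 5 :> R; last by lra.
have -> : 17 / 5 = ((17 / 5) ^+ 2) `^ 2^-1 :> R.
  have h : 0 <= 17 / 5 :> R by rewrite divr_ge0.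
  by rewrite -(powR_mulrn 2 h) -powRrM mulfV// powRr1.
have h : 0 <= 2 * (1 + 1 / 10) :> R by lra.
have -> : (2 / 3)^-1 = 3%:R * 2^-1 :> R by field.
rewrite powRrM powR_mulrn//; apply: ge0_ler_powR; rewrite ?nnegrE ?exprn_ge0 ?invr_ge0//.
by rewrite !exprS !expr0; lra.
Qed.

Theorem theorem1p5 (R : realType) :
  exists C : R, 0 < C /\
    forall (eps p : R) (p2 : 2 <= p), 0 < eps -> eps <= 1 / 2 ->
      exists F : heis -> Lp01 (le1_of_le2 p2),
        doubling (@Lp_dist R p (le1_of_le2 p2)) (range F) (2 ^+ 16) /\
        forall x y : heis,
          (dW x y)%:R `^ (1 - eps) <= Lp_dist (F x) (F y) /\
          Lp_dist (F x) (F y) <=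
            C * ((dW x y)%:R `^ (1 - eps) / eps `^ (1 / p)).
Proof.
have [A AE] : exists A : R, A = 2 * (12 * 2 * 384) * (162 * 2) by eexists.
have A0 : 0 < A by rewrite AE; lra.
exists (5 * A); split; first by rewrite mulr_gt0.
move=> eps p p2 eps0 epsh.
have p0 : 0 < p by exact: lt_le_trans p2.
have p1 : 1 <= p by apply: le_trans p2; rewrite ler1n.
have epsp : 1 <= (1 - eps) * p by nra.
have eps1 : eps < 1 by lra.
(* Shared by both ranges: replacing e by eps costs at most 5^(1/p) <= 5. *)
have final e (F : heis -> Lp01 (le1_of_le2 p2)) : 0 < e -> eps <= 5 * e ->
  (forall x y : heis, (dW x y)%:R `^ (1 - eps) <= Lp_dist (F x) (F y) <=
    A * ((dW x y)%:R `^ (1 - eps) / e `^ p^-1)) ->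
  forall x y : heis,
    (dW x y)%:R `^ (1 - eps) <= Lp_dist (F x) (F y) /\
    Lp_dist (F x) (F y) <= 5 * A * ((dW x y)%:R `^ (1 - eps) / eps `^ (1 / p)).
  move=> e0 e5 FP x y; have /andP[h1 h2] := FP x y; split => //.
  apply: le_trans h2 _; rewrite mul1r [5 * A]mulrC -mulrA.
  apply: ler_wpM2l; first exact: ltW.
  rewrite mulrCA; apply: ler_wpM2l; first exact: powR_ge0.
  rewrite -ler_pdivrMl// -invfM lef_pV2 ?posrE ?powR_gt0 ?mulr_gt0 ?powR_gt0//.
  apply: (@le_trans _ _ ((5 * e) `^ p^-1)).
    by rewrite ge0_ler_powR ?nnegrE ?invr_ge0 ?mulr_ge0 ?(ltW e0) ?(ltW p0) ?(ltW eps0).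
  rewrite powRM ?(ltW e0)// ler_wpM2r ?powR_ge0//.
  by rewrite ler1_powR ?ler1n// invf_le1.
have [small|large] := leP eps (2 / 5).
  have [F [dF FP]] : exists F : heis -> Lp01 (le1_of_le2 p2),
      doubling (@Lp_dist R p (le1_of_le2 p2)) (range F) (2 ^+ 16) /\
      forall x y : heis, (dW x y)%:R `^ ((1 - eps) * 1) <= Lp_dist (F x) (F y) <=
        2 * (12 * 2 * 384) * (162 * 2) * ((dW x y)%:R `^ ((1 - eps) * 1) / eps `^ p^-1).
    apply: (core_embedding _ _ _ _ _ _ _ _ _ (snowflake_id p0)); rewrite ?mulr1//.
    rewrite addr0 mulr1 invr1 powRr1//.
    by apply: le_lt_trans (lt5_16powR (_ : 3 / 5 <= 1 - eps)); lra.
  exists F; split => //; apply: (final eps F eps0); first by lra.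
  by move=> x y; have := FP x y; rewrite mulr1 -AE.
pose th : R := 2 / 3.
have [psi psiP] : exists psi : int -> int -> R, snowflake p th (1 / 10) psi.
  apply: snowflake_exists => //; rewrite /th; apply/andP; split; last by lra.
  by rewrite invf_plt ?posrE// ?divr_gt0// invf_div; lra.
(* For 2/5 < eps <= 1/2 this lies between 1/10 and 1/4, whence both eps <= 5 e and 1 - e >= 3/4. *)
pose e := 1 - (1 - eps) * (3 / 2).
have eE : (1 - e) * th = 1 - eps by rewrite /e /th; field.
have [F [dF FP]] : exists F : heis -> Lp01 (le1_of_le2 p2),
    doubling (@Lp_dist R p (le1_of_le2 p2)) (range F) (2 ^+ 16) /\
    forall x y : heis, (dW x y)%:R `^ ((1 - e) * th) <= Lp_dist (F x) (F y) <=
      2 * (12 * 2 * 384) * (162 * 2) * ((dW x y)%:R `^ ((1 - e) * th) / e `^ p^-1).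
  apply: (core_embedding _ _ _ _ _ _ _ _ _ psiP).
  - by rewrite /th; lra.
  - by rewrite /th; lra.
  - by rewrite /th; lra.
  - by rewrite /e; lra.
  - by rewrite /e; lra.
  - by rewrite (mulrC p) mulrA eE.
  - by lra.
  - by lra.
  by apply: gap_16powR; rewrite /e; lra.
exists F; split => //; apply: (final e F); [by rewrite /e; lra|by rewrite /e; lra|].
by move=> x y; have := FP x y; rewrite eE -AE.
Qed.
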